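(* Let $v,a,b,c\in\mathbb{C}$ with $\Re(v)<2$, $\Re(c)>0$, and $\Re(vc+a+b)>0$, $\Re(vc+a-b)>0$, $\Re(vc-a+b)>0$, $\Re(vc-a-b)>0$. Fix a square root $\sqrt{a^2-b^2}$ and put $\sigma_1=\frac v2-\frac{\sqrt{a^2-b^2}}{2c}$, $\sigma_2=\frac v2+\frac{\sqrt{a^2-b^2}}{2c}$, $\sigma_3=\frac v2-\frac{a}{2c}-\frac{b}{2c}$, $\sigma_4=\frac v2-\frac{a}{2c}+\frac{b}{2c}$, $\sigma_5=\frac v2+\frac{a}{2c}+\frac{b}{2c}$, $\sigma_6=\frac v2+\frac{a}{2c}-\frac{b}{2c}$, $P=(vc-a-b)(vc+a+b)(vc-a+b)(vc+a-b)$; assume $\sigma_1,\sigma_2\notin\mathbb{Z}_0^-$ and $1+\sigma_j\notin\mathbb{Z}_0^-$ ($j=3,4,5,6$). Then $$ \int_0^\infty\frac{\sinh(ax)\cosh(bx)}{\sinh^{v}(cx)}\,dx=\frac{2^{v}(v^2ac^2-a^3+ab^2)}{P}\;{}_7F_6\!\left(\begin{matrix}v,\ 1+\sigma_1,\ 1+\sigma_2,\ \sigma_3,\ \sigma_4,\ \sigma_5,\ \sigma_6\\ \sigma_1,\ \sigma_2,\ 1+\sigma_3,\ 1+\sigma_4,\ 1+\sigma_5,\ 1+\sigma_6\end{matrix};\,1\right). $$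
   Context: $\mathbb{Z}_0^-=\{0,-1,-2,\dots\}$. The Pochhammer symbol is $(\lambda)_0=1$, $(\lambda)_n=\lambda(\lambda+1)\cdots(\lambda+n-1)$ for $n\ge1$. The generalized hypergeometric series is ${}_pF_q\!\left(\begin{matrix}\alpha_1,\dots,\alpha_p\\ \beta_1,\dots,\beta_q\end{matrix};z\right)=\sum_{n=0}^\infty\frac{(\alpha_1)_n\cdots(\alpha_p)_n}{(\beta_1)_n\cdots(\beta_q)_n}\frac{z^n}{n!}$ (with no $\beta_j\in\mathbb{Z}_0^-$); when $p=q+1$ and $z=1$ it converges if $\Re(\sum\beta_j-\sum\alpha_i)>0$. For $\Re(c)>0$ and $x>0$, the complex power $\sinh^{v}(cx)$ means $2^{-v}e^{vcx}(1-e^{-2cx})^{v}$, with the principal branch of $(1-e^{-2cx})^{v}$ (this agrees with the ordinary real power when $c>0$ and $v$ is real). *)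

(* Defs.v *)
From Stdlib Require Import Reals Lra List Arith Factorial.
Open Scope R_scope.

Definition Cplx : Type := (R * R)%type.
Definition Re (z : Cplx) : R := fst z.
Definition Im (z : Cplx) : R := snd z.
Definition RtoC (x : R) : Cplx := (x, 0).
Definition Czero : Cplx := (0, 0).
Definition Cone : Cplx := (1, 0).
Definition Cadd (z w : Cplx) : Cplx := (fst z + fst w, snd z + snd w).
Definition Copp (z : Cplx) : Cplx := (- fst z, - snd z).
Definition Csub (z w : Cplx) : Cplx := Cadd z (Copp w).
Definition Cmul (z w : Cplx) : Cplx :=
  (fst z * fst w - snd z * snd w, fst z * snd w + snd z * fst w).
Definition Cnorm2 (z : Cplx) : R := fst z * fst z + snd z * snd z.
Definition Cnorm (z : Cplx) : R := sqrt (Cnorm2 z).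
Definition Cinv (z : Cplx) : Cplx := (fst z / Cnorm2 z, - snd z / Cnorm2 z).
Definition Cdiv (z w : Cplx) : Cplx := Cmul z (Cinv w).

Definition Cexp (z : Cplx) : Cplx := (exp (fst z) * cos (snd z), exp (fst z) * sin (snd z)).

Definition Carg (z : Cplx) : R :=
  let x := fst z in let y := snd z in
  match Rlt_dec 0 x with
  | left _ => atan (y / x)
  | right _ =>
    match Rlt_dec x 0 with
    | left _ => match Rle_dec 0 y with
                | left _ => atan (y / x) + PI
                | right _ => atan (y / x) - PI
                end
    | right _ =>
      match Rlt_dec 0 y with
      | left _ => PI / 2
      | right _ => match Rlt_dec y 0 with
                   | left _ => - (PI / 2)
                   | right _ => 0
                   end
      end
    end
  end.

Definition Clog (z : Cplx) : Cplx := (ln (Cnorm z), Carg z).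

(* principal power w^v = exp (v * Log w), used for w <> 0 *)
Definition Cpow (w v : Cplx) : Cplx := Cexp (Cmul v (Clog w)).

Fixpoint Cpown (z : Cplx) (n : nat) : Cplx :=
  match n with O => Cone | S k => Cmul (Cpown z k) z end.

Definition Csinh (z : Cplx) : Cplx := Cdiv (Csub (Cexp z) (Cexp (Copp z))) (RtoC 2).
Definition Ccosh (z : Cplx) : Cplx := Cdiv (Cadd (Cexp z) (Cexp (Copp z))) (RtoC 2).

(* sinh^v(c x) := 2^{-v} e^{v c x} (1 - e^{-2 c x})^v, principal branch *)
Definition sinh_pow (c v : Cplx) (x : R) : Cplx :=
  Cmul (Cmul (Cpow (RtoC 2) (Copp v)) (Cexp (Cmul v (Cmul c (RtoC x)))))
       (Cpow (Csub Cone (Cexp (Cmul (RtoC (-2)) (Cmul c (RtoC x))))) v).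

Fixpoint poch (z : Cplx) (n : nat) : Cplx :=
  match n with O => Cone | S k => Cmul (poch z k) (Cadd z (RtoC (INR k))) end.

Definition in_Z0neg (z : Cplx) : Prop := exists n : nat, z = RtoC (- INR n).

Definition prod_poch (l : list Cplx) (n : nat) : Cplx :=
  fold_right (fun a acc => Cmul (poch a n) acc) Cone l.
Definition hyp_term (al be : list Cplx) (z : Cplx) (n : nat) : Cplx :=
  Cdiv (Cmul (prod_poch al n) (Cpown z n))
       (Cmul (prod_poch be n) (RtoC (INR (fact n)))).

Fixpoint Cpartial (u : nat -> Cplx) (n : nat) : Cplx :=
  match n with O => u O | S k => Cadd (Cpartial u k) (u (S k)) end.
Definition Cseries_cv (u : nat -> Cplx) (S : Cplx) : Prop :=
  forall eps, 0 < eps -> exists N, forall n, (N <= n)%nat -> Cnorm (Csub (Cpartial u n) S) < eps.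

Definition C_integral_is (f : R -> Cplx) (a b : R) (I : Cplx) : Prop :=
  exists (pr1 : Riemann_integrable (fun x => fst (f x)) a b)
         (pr2 : Riemann_integrable (fun x => snd (f x)) a b),
    RiemannInt pr1 = fst I /\ RiemannInt pr2 = snd I.

Definition improper_integral_0_inf (f : R -> Cplx) (I : Cplx) : Prop :=
  (forall a b, 0 < a -> a <= b -> exists J, C_integral_is f a b J) /\
  (forall eps, 0 < eps -> exists d M, 0 < d /\
     forall a b J, 0 < a -> a < d -> M < b -> a < b ->
       C_integral_is f a b J -> Cnorm (Csub J I) < eps).

(* Main.v *)
From Coquelicot Require Import Coquelicot.
Require Import Defs.
From Stdlib Require Import Reals Ranalysis5 Factorial List Lra Lia Psatz.
Import ListNotations.
Open Scope R_scope.

(** Since [Re c > 0], the binomial series expands [sinh^(-v) (c x)] into the exponentials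
    [exp (- (v + 2 n) c x)], and [sinh (a x) cosh (b x)] is half the sum of [sinh (w x)] for
    [w = a + b] and [w = a - b]. Integrating termwise gives
    [sum_n (v)_n / n! * w / (mu_n^2 - w^2)] with [mu_n = (v + 2 n) c]; adding the two values of [w]
    produces [a (mu_n^2 - (a^2 - b^2))] over a product of four linear factors in [mu_n], which is
    the term of the 7F6 series. Instead of integrating termwise one sums termwise antiderivatives:
    they are O(n^-2) uniformly in [x >= 0], and [sum_n |(v)_n / n!| n^-2] converges exactly
    because [Re v < 2]. Dominated convergence at 0 and at infinity then evaluates the integral. *)

(* The two ends of the half-line ask for different estimates. Near a point x > 0 the differentiated
   series has a geometric majorant, but its ratio tends to 1 as x tends to 0, where the integrand
   may be singular. The antiderivatives do have one majorant on the whole half-line, provided that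
   the exponentials with rates mu_n - w and mu_n + w stay together: each alone contributes order
   1/n, which would only reach Re v < 1, while their difference gains a further factor 1/n. The
   weight is (n + 1)(n + 2) rather than n^2 because the ratio of consecutive terms is then |v + n| /
   (n + 3), so that Kummer's test applies to the recurrence of the coefficients directly, without
   asymptotics of the Gamma function. The branch of the complex power is harmless: 1 - exp(-2 c x)
   has positive real part, so the principal logarithm is differentiable there, and the binomial
   theorem with complex exponent reduces to a differential equation on a real segment. Derivatives,
   continuity and series are handled through real and imaginary parts, since the integral of the
   statement is a pair of real Riemann integrals. *)
Declare Scope cplx_scope.
Delimit Scope cplx_scope with X.
Bind Scope cplx_scope with Cplx.
Local Infix "+" := Cadd : cplx_scope.
Local Infix "-" := Csub : cplx_scope.
Local Infix "*" := Cmul : cplx_scope.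
Local Infix "/" := Cdiv : cplx_scope.
Local Notation "- z" := (Copp z) : cplx_scope.
Local Notation "/ z" := (Cinv z) : cplx_scope.
Local Notation "0" := Czero : cplx_scope.
Local Notation "1" := Cone : cplx_scope.
Local Notation "2" := (RtoC 2) : cplx_scope.

(** * Field structure and modulus of the complex numbers as pairs *)

Lemma Cplx_eq (z w : Cplx) : fst z = fst w -> snd z = snd w -> z = w.
Proof. destruct z, w; simpl; intros; subst; reflexivity. Qed.

Lemma Cnorm2_pos (z : Cplx) : z <> 0%X -> 0 < Cnorm2 z.
Proof.
  destruct z as [x y]; unfold Cnorm2; simpl; intros H.
  destruct (Req_dec x 0) as [->|Hx].
  - destruct (Req_dec y 0) as [->|Hy]; [now elim H|]. nra.
  - nra.
Qed.

Lemma Cplx_ring : ring_theory Czero Cone Cadd Cmul Csub Copp (@eq Cplx).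
Proof.
  constructor; intros; apply Cplx_eq; simpl; ring.
Qed.

Lemma Cplx_field : field_theory Czero Cone Cadd Cmul Csub Copp Cdiv Cinv (@eq Cplx).
Proof.
  constructor; [exact Cplx_ring| |reflexivity|].
  - intros H; apply (f_equal fst) in H; simpl in H; lra.
  - intros z Hz. pose proof (Cnorm2_pos z Hz) as P. unfold Cnorm2 in P.
    apply Cplx_eq; unfold Cinv, Cmul, Cone, Cnorm2; simpl; field; lra.
Qed.
Add Field Cplx_field_inst : Cplx_field.

Lemma Cnorm_Cmod (z : Cplx) : Cnorm z = Cmod z.
Proof. unfold Cnorm, Cnorm2, Cmod. f_equal. ring. Qed.

Lemma Cnorm_ge_0 (z : Cplx) : 0 <= Cnorm z.
Proof. apply sqrt_pos. Qed.

Lemma Cnorm_0 : Cnorm 0 = 0.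
Proof. rewrite Cnorm_Cmod. apply Cmod_0. Qed.

Lemma Cnorm_1 : Cnorm 1 = 1.
Proof. rewrite Cnorm_Cmod. apply Cmod_1. Qed.

Lemma Cnorm_mul (z w : Cplx) : Cnorm (z * w) = Cnorm z * Cnorm w.
Proof. rewrite !Cnorm_Cmod. apply (Cmod_mult z w). Qed.

Lemma Cnorm_add (z w : Cplx) : Cnorm (z + w) <= Cnorm z + Cnorm w.
Proof. rewrite !Cnorm_Cmod. apply (Cmod_triangle z w). Qed.

Lemma Cnorm_opp (z : Cplx) : Cnorm (- z) = Cnorm z.
Proof. unfold Cnorm, Cnorm2; simpl; f_equal; ring. Qed.

Lemma Cnorm_sub (z w : Cplx) : Cnorm (z - w) <= Cnorm z + Cnorm w.
Proof. rewrite <- (Cnorm_opp w). apply Cnorm_add. Qed.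

Lemma Cnorm_pos (z : Cplx) : z <> 0%X -> 0 < Cnorm z.
Proof. intros H. apply sqrt_lt_R0, Cnorm2_pos, H. Qed.

Lemma Cnorm_inv (z : Cplx) : z <> 0%X -> Cnorm (/ z) = / Cnorm z.
Proof.
  intros H. apply Rmult_eq_reg_l with (Cnorm z).
  - rewrite <- Cnorm_mul, Rinv_r by (apply Rgt_not_eq, Cnorm_pos, H).
    replace (z * / z)%X with 1%X by (field; exact H). apply Cnorm_1.
  - apply Rgt_not_eq, Cnorm_pos, H.
Qed.

Lemma Cnorm_div (z w : Cplx) : w <> 0%X -> Cnorm (z / w) = Cnorm z / Cnorm w.
Proof. intros H. unfold Cdiv. now rewrite Cnorm_mul, Cnorm_inv. Qed.

Lemma Cnorm_RtoC (x : R) : Cnorm (RtoC x) = Rabs x.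
Proof.
  unfold Cnorm, Cnorm2; simpl. replace (x * x + 0 * 0) with (Rsqr x) by (unfold Rsqr; ring).
  apply sqrt_Rsqr_abs.
Qed.

Lemma Cnorm_fst (z : Cplx) : Rabs (fst z) <= Cnorm z.
Proof.
  rewrite <- sqrt_Rsqr_abs. apply sqrt_le_1_alt. unfold Rsqr, Cnorm2. nra.
Qed.

Lemma Cnorm_snd (z : Cplx) : Rabs (snd z) <= Cnorm z.
Proof.
  rewrite <- sqrt_Rsqr_abs. apply sqrt_le_1_alt. unfold Rsqr, Cnorm2. nra.
Qed.

Lemma Cnorm_le_add_abs (z : Cplx) : Cnorm z <= Rabs (fst z) + Rabs (snd z).
Proof.
  pose proof (Rabs_pos (fst z)). pose proof (Rabs_pos (snd z)).
  rewrite <- (sqrt_Rsqr (Rabs (fst z) + Rabs (snd z))) by lra.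
  apply sqrt_le_1_alt. unfold Cnorm2.
  pose proof (Rsqr_abs (fst z)). pose proof (Rsqr_abs (snd z)). unfold Rsqr in *. nra.
Qed.

Lemma RtoC_neq_0 (x : R) : x <> 0 -> RtoC x <> 0%X.
Proof. intros H E. apply H. apply (f_equal fst) in E. exact E. Qed.

Lemma RtoC_2 : RtoC 2 = (1 + 1)%X.
Proof. apply Cplx_eq; simpl; ring. Qed.

Lemma Re_pos_neq_0 (z : Cplx) : 0 < Re z -> z <> 0%X.
Proof. intros H E; subst z; simpl in H; lra. Qed.

Lemma Cmul_neq_0 (z w : Cplx) : z <> 0%X -> w <> 0%X -> (z * w)%X <> 0%X.
Proof.
  intros Hz Hw E. apply Hw. replace w with (/ z * (z * w))%X by (field; exact Hz).
  rewrite E. ring.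
Qed.

(** * The complex exponential *)

Lemma Cexp_add (z w : Cplx) : Cexp (z + w) = (Cexp z * Cexp w)%X.
Proof.
  apply Cplx_eq; simpl; rewrite exp_plus; [rewrite cos_plus|rewrite sin_plus]; ring.
Qed.

Lemma Cexp_0 : Cexp 0 = 1%X.
Proof. apply Cplx_eq; simpl; rewrite exp_0, ?cos_0, ?sin_0; ring. Qed.

Lemma Cnorm_Cexp (z : Cplx) : Cnorm (Cexp z) = exp (Re z).
Proof.
  unfold Cnorm, Cnorm2; simpl.
  replace (_ + _) with (Rsqr (exp (fst z))).
  - apply sqrt_Rsqr. left. apply exp_pos.
  - pose proof (sin2_cos2 (snd z)) as H. unfold Rsqr in *.
    transitivity (exp (fst z) * exp (fst z)
      * (sin (snd z) * sin (snd z) + cos (snd z) * cos (snd z))); [rewrite H|]; ring.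
Qed.

Lemma Cexp_neq_0 (z : Cplx) : Cexp z <> 0%X.
Proof.
  intros E. apply (f_equal Cnorm) in E. rewrite Cnorm_Cexp, Cnorm_0 in E.
  pose proof (exp_pos (Re z)). lra.
Qed.

Lemma Cexp_opp (z : Cplx) : Cexp (- z) = (/ Cexp z)%X.
Proof.
  transitivity (Cexp (- z) * Cexp z * / Cexp z)%X.
  - field. apply Cexp_neq_0.
  - rewrite <- Cexp_add. replace (- z + z)%X with 0%X by ring. rewrite Cexp_0. ring.
Qed.

(** * Complex-valued functions of a real variable *)

(** Componentwise, so that the mean value theorem, termwise differentiation and the fundamental
    theorem of calculus are used in their real form, on each part. *)
Definition is_Cderive (f : R -> Cplx) (x : R) (l : Cplx) : Prop :=
  is_derive (fun t => fst (f t)) x (fst l) /\ is_derive (fun t => snd (f t)) x (snd l).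

Definition Ccontinuous (f : R -> Cplx) (x : R) : Prop :=
  continuous (fun t => fst (f t)) x /\ continuous (fun t => snd (f t)) x.

Lemma is_Cderive_continuous (f : R -> Cplx) (x : R) (l : Cplx) :
  is_Cderive f x l -> Ccontinuous f x.
Proof.
  intros [H1 H2]; split.
  - apply @ex_derive_continuous. now exists (fst l).
  - apply @ex_derive_continuous. now exists (snd l).
Qed.

Lemma Ccontinuous_norm (f : R -> Cplx) (x eps : R) :
  Ccontinuous f x -> 0 < eps -> locally x (fun y => Cnorm (f y - f x) < eps).
Proof.
  intros [C1 C2] He. assert (He2 : 0 < eps / 2) by lra.
  assert (L1 : locally x (fun y => Rabs (fst (f y) - fst (f x)) < eps / 2))
    by exact (C1 _ (locally_ball _ (mkposreal _ He2))).
  assert (L2 : locally x (fun y => Rabs (snd (f y) - snd (f x)) < eps / 2))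
    by exact (C2 _ (locally_ball _ (mkposreal _ He2))).
  generalize (filter_and _ _ L1 L2). apply filter_imp. intros y [B1 B2]. unfold Rminus in *.
  eapply Rle_lt_trans; [apply Cnorm_le_add_abs|]. simpl. lra.
Qed.

Lemma is_Cderive_eq (f : R -> Cplx) (x : R) (l l' : Cplx) :
  is_Cderive f x l -> l = l' -> is_Cderive f x l'.
Proof. now intros H <-. Qed.

Lemma is_Cderive_ext_loc (f g : R -> Cplx) (x : R) (l : Cplx) :
  locally x (fun t => f t = g t) -> is_Cderive f x l -> is_Cderive g x l.
Proof.
  intros E [H1 H2]; split.
  - apply (is_derive_ext_loc (fun t => fst (f t))); [|exact H1].
    revert E; apply filter_imp. now intros t ->.
  - apply (is_derive_ext_loc (fun t => snd (f t))); [|exact H2].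
    revert E; apply filter_imp. now intros t ->.
Qed.

Lemma is_Cderive_ext (f g : R -> Cplx) (x : R) (l : Cplx) :
  (forall t, f t = g t) -> is_Cderive f x l -> is_Cderive g x l.
Proof. intros E. apply is_Cderive_ext_loc. apply filter_forall. exact E. Qed.

Lemma is_Cderive_const (z : Cplx) (x : R) : is_Cderive (fun _ => z) x 0%X.
Proof. split; simpl; auto_derive; auto. Qed.

Lemma is_Cderive_RtoC (x : R) : is_Cderive RtoC x 1%X.
Proof. split; simpl; auto_derive; auto. Qed.

Lemma is_Cderive_RtoC_comp (f : R -> R) (x l : R) :
  is_derive f x l -> is_Cderive (fun t => RtoC (f t)) x (RtoC l).
Proof. intros H; split; simpl; [exact H|auto_derive; auto]. Qed.

Lemma is_Cderive_add (f g : R -> Cplx) (x : R) (l m : Cplx) :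
  is_Cderive f x l -> is_Cderive g x m ->
  is_Cderive (fun t => f t + g t)%X x (l + m)%X.
Proof.
  intros [H1 H2] [H3 H4]; split; simpl.
  - exact (is_derive_plus _ _ _ _ _ H1 H3).
  - exact (is_derive_plus _ _ _ _ _ H2 H4).
Qed.

Lemma is_derive_mul_R (f g : R -> R) (x l m : R) :
  is_derive f x l -> is_derive g x m -> is_derive (fun t => f t * g t) x (l * g x + f x * m).
Proof.
  intros H1 H2. apply (is_derive_mult f g); auto. exact Rmult_comm.
Qed.

Lemma is_Cderive_mul (f g : R -> Cplx) (x : R) (l m : Cplx) :
  is_Cderive f x l -> is_Cderive g x m ->
  is_Cderive (fun t => f t * g t)%X x (l * g x + f x * m)%X.
Proof.
  intros [H1 H2] [H3 H4]; split; simpl.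
  - replace (_ + _) with
      (minus (fst l * fst (g x) + fst (f x) * fst m) (snd l * snd (g x) + snd (f x) * snd m))
      by (unfold minus, plus, opp; simpl; ring).
    apply @is_derive_minus.
    + now apply (is_derive_mul_R (fun t => fst (f t)) (fun t => fst (g t))).
    + now apply (is_derive_mul_R (fun t => snd (f t)) (fun t => snd (g t))).
  - replace (_ + _) with
      (plus (fst l * snd (g x) + fst (f x) * snd m) (snd l * fst (g x) + snd (f x) * fst m))
      by (unfold plus; simpl; ring).
    apply @is_derive_plus.
    + now apply (is_derive_mul_R (fun t => fst (f t)) (fun t => snd (g t))).
    + now apply (is_derive_mul_R (fun t => snd (f t)) (fun t => fst (g t))).
Qed.

Lemma is_Cderive_scal (z : Cplx) (f : R -> Cplx) (x : R) (l : Cplx) :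
  is_Cderive f x l -> is_Cderive (fun t => z * f t)%X x (z * l)%X.
Proof.
  intros H. eapply is_Cderive_eq.
  - apply (is_Cderive_mul _ _ _ _ _ (is_Cderive_const z x) H).
  - ring.
Qed.

Lemma is_Cderive_Cexp (f : R -> Cplx) (x : R) (l : Cplx) :
  is_Cderive f x l -> is_Cderive (fun t => Cexp (f t)) x (l * Cexp (f x))%X.
Proof.
  cut (forall p q : R -> R, is_derive p x (fst l) -> is_derive q x (snd l) ->
    is_Cderive (fun t => Cexp (p t, q t)) x (l * Cexp (p x, q x))%X).
  { intros H [H1 H2].
    generalize (H (fun t => fst (f t)) (fun t => snd (f t)) H1 H2).
    rewrite <- surjective_pairing. apply is_Cderive_ext.
    intros t. now rewrite <- surjective_pairing. }
  intros p q H1 H2.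
  assert (E1 : Derive (fun t => p t) x = fst l) by now apply is_derive_unique.
  assert (E2 : Derive (fun t => q t) x = snd l) by now apply is_derive_unique.
  split; simpl; auto_derive.
  - repeat split; eexists; eassumption.
  - rewrite E1, E2. ring.
  - repeat split; eexists; eassumption.
  - rewrite E1, E2. ring.
Qed.

(** In the right half-plane the logarithm has real part ln(p^2 + q^2) / 2 and imaginary part atan(q
    / p), with no case distinction. Continuity keeps p positive near x, so the derivative may be
    computed from this formula. *)
Lemma is_Cderive_Clog (f : R -> Cplx) (x : R) (l : Cplx) :
  is_Cderive f x l -> 0 < Re (f x) -> is_Cderive (fun t => Clog (f t)) x (l / f x)%X.
Proof.
  cut (forall p q : R -> R, is_derive p x (fst l) -> is_derive q x (snd l) -> 0 < p x ->
    is_Cderive (fun t => Clog (p t, q t)) x (l / (p x, q x))%X).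
  { intros H [H1 H2] Hp.
    generalize (H (fun t => fst (f t)) (fun t => snd (f t)) H1 H2 Hp).
    rewrite <- surjective_pairing. apply is_Cderive_ext.
    intros t. now rewrite <- surjective_pairing. }
  intros p q H1 H2 Hp.
  assert (L : locally x (fun t => 0 < p t)).
  { assert (C1 : continuous p x) by (apply @ex_derive_continuous; now exists (fst l)).
    apply (C1 (fun y => 0 < y)). apply open_gt. exact Hp. }
  apply is_Cderive_ext_loc with
    (fun t => (/ 2 * ln (p t * p t + q t * q t), atan (q t / p t))).
  { revert L; apply filter_imp; intros t Ht. unfold Clog, Carg, Cnorm, Cnorm2.
    apply Cplx_eq; simpl.
    - assert (0 < p t * p t + q t * q t) by nra.
      rewrite <- Rpower_sqrt by easy. unfold Rpower. now rewrite ln_exp.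
    - destruct (Rlt_dec 0 (p t)); [reflexivity|contradiction]. }
  assert (E1 : Derive (fun t => p t) x = fst l) by now apply is_derive_unique.
  assert (E2 : Derive (fun t => q t) x = snd l) by now apply is_derive_unique.
  assert (N : 0 < p x * p x + q x * q x) by nra.
  unfold Cdiv, Cmul, Cinv, Cnorm2; split; simpl; auto_derive.
  - repeat split; try (eexists; eassumption); assumption.
  - rewrite E1, E2. field. lra.
  - repeat split; try (eexists; eassumption); lra.
  - rewrite E1, E2. field. nra.
Qed.

Lemma Cconstant_of_derive_0 (f : R -> Cplx) (x y : R) :
  (forall t, x <= t <= y -> is_Cderive f t 0) -> x < y -> f x = f y.
Proof.
  intros H Hxy. apply Cplx_eq.
  - apply (eq_is_derive (fun t => fst (f t))); [|exact Hxy]. intros t Ht. apply (H t Ht).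
  - apply (eq_is_derive (fun t => snd (f t))); [|exact Hxy]. intros t Ht. apply (H t Ht).
Qed.

(** On the segment from [w] to [z] the real part stays below [m] by convexity, so the derivative
    along it has modulus at most |z - w| e^m. The mean value theorem is applied to the real and to
    the imaginary part, possibly at different points; hence the factor 2. *)
Lemma Cexp_Lipschitz (z w : Cplx) (m : R) :
  Re z <= m -> Re w <= m -> Cnorm (Cexp z - Cexp w) <= 2 * (Cnorm (z - w) * exp m).
Proof.
  intros Hz Hw.
  set (h := fun t : R => Cexp (w + (z - w) * RtoC t)).
  set (h' := fun t : R => ((z - w) * h t)%X).
  assert (D : forall t, is_Cderive h t (h' t)).
  { intros t. unfold h, h'. apply is_Cderive_Cexp.
    eapply is_Cderive_eq.
    - apply is_Cderive_add; [apply is_Cderive_const|apply is_Cderive_scal, is_Cderive_RtoC].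
    - ring. }
  assert (B : forall t, 0 <= t <= 1 -> Cnorm (h' t) <= Cnorm (z - w) * exp m).
  { intros t Ht. unfold h', h. rewrite Cnorm_mul, Cnorm_Cexp.
    apply Rmult_le_compat_l; [apply Cnorm_ge_0|].
    assert (E : Re (w + (z - w) * RtoC t) <= m) by (unfold Re in *; simpl; nra).
    destruct E as [E| ->]; [left; now apply exp_increasing|lra]. }
  assert (E1 : h 1 = Cexp z) by (unfold h; f_equal; change (RtoC 1) with Cone; ring).
  assert (E0 : h 0 = Cexp w) by (unfold h; f_equal; change (RtoC 0) with Czero; ring).
  rewrite <- E1, <- E0.
  eapply Rle_trans; [apply Cnorm_le_add_abs|].
  enough (Rabs (fst (h 1%R - h 0%R)%X) <= Cnorm (z - w) * exp m
    /\ Rabs (snd (h 1%R - h 0%R)%X) <= Cnorm (z - w) * exp m) by lra.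
  split.
  - destruct (MVT_gen (fun t => fst (h t)) 0 1 (fun t => fst (h' t))) as (t & Ht & E).
    + intros t _. apply D.
    + intros t _. apply derivable_continuous_pt. exists (fst (h' t)).
      apply is_derive_Reals, D.
    + rewrite Rmin_left, Rmax_right in Ht by lra.
      change (fst (h 1%R - h 0%R)%X) with (fst (h 1) - fst (h 0)). rewrite E, Rminus_0_r, Rmult_1_r.
      eapply Rle_trans; [apply Cnorm_fst|auto].
  - destruct (MVT_gen (fun t => snd (h t)) 0 1 (fun t => snd (h' t))) as (t & Ht & E).
    + intros t _. apply D.
    + intros t _. apply derivable_continuous_pt. exists (snd (h' t)).
      apply is_derive_Reals, D.
    + rewrite Rmin_left, Rmax_right in Ht by lra.
      change (snd (h 1%R - h 0%R)%X) with (snd (h 1) - snd (h 0)). rewrite E, Rminus_0_r, Rmult_1_r.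
      eapply Rle_trans; [apply Cnorm_snd|auto].
Qed.

(** * Series *)

Definition is_Cseries (u : nat -> Cplx) (S : Cplx) : Prop :=
  is_series (fun n => fst (u n)) (fst S) /\ is_series (fun n => snd (u n)) (snd S).

(** A total function, whose value has a meaning only for a convergent series; [is_Cseries] or a
    summable majorant supplies the convergence. *)
Definition CSeries (u : nat -> Cplx) : Cplx :=
  (Series (fun n => fst (u n)), Series (fun n => snd (u n))).

Lemma is_Cseries_unique (u : nat -> Cplx) (S : Cplx) : is_Cseries u S -> CSeries u = S.
Proof. intros [H1 H2]. apply Cplx_eq; simpl; now apply is_series_unique. Qed.

Lemma is_Cseries_ext (u w : nat -> Cplx) (S : Cplx) :
  (forall n, u n = w n) -> is_Cseries u S -> is_Cseries w S.
Proof.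
  intros E [H1 H2]; split.
  - revert H1. apply is_series_ext. intros n. now rewrite E.
  - revert H2. apply is_series_ext. intros n. now rewrite E.
Qed.

Lemma CSeries_ext (u w : nat -> Cplx) : (forall n, u n = w n) -> CSeries u = CSeries w.
Proof. intros E. apply Cplx_eq; simpl; apply Series_ext; intros n; now rewrite E. Qed.

Lemma is_Cseries_add (u w : nat -> Cplx) (S T : Cplx) :
  is_Cseries u S -> is_Cseries w T -> is_Cseries (fun n => u n + w n)%X (S + T)%X.
Proof.
  intros [H1 H2] [H3 H4]; split.
  - exact (is_series_plus _ _ _ _ H1 H3).
  - exact (is_series_plus _ _ _ _ H2 H4).
Qed.

Lemma is_Cseries_scal (z : Cplx) (u : nat -> Cplx) (S : Cplx) :
  is_Cseries u S -> is_Cseries (fun n => z * u n)%X (z * S)%X.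
Proof.
  intros [H1 H2]; split; simpl.
  - exact (is_series_minus _ _ _ _ (is_series_scal (fst z) _ _ H1) (is_series_scal (snd z) _ _ H2)).
  - exact (is_series_plus _ _ _ _ (is_series_scal (fst z) _ _ H2) (is_series_scal (snd z) _ _ H1)).
Qed.

Lemma is_Cseries_of_bound (u : nat -> Cplx) (M : nat -> R) :
  ex_series M -> (forall n, Cnorm (u n) <= M n) -> is_Cseries u (CSeries u).
Proof.
  intros HM H; split; apply Series_correct.
  - apply (ex_series_le (V := R_CompleteNormedModule) _ M); [|exact HM].
    intros n. eapply Rle_trans; [apply Cnorm_fst|apply H].
  - apply (ex_series_le (V := R_CompleteNormedModule) _ M); [|exact HM].
    intros n. eapply Rle_trans; [apply Cnorm_snd|apply H].
Qed.

Lemma is_Cseries_Cseries_cv (u : nat -> Cplx) (S : Cplx) : is_Cseries u S -> Cseries_cv u S.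
Proof.
  intros [H1 H2] eps Heps.
  apply is_series_Reals in H1. apply is_series_Reals in H2.
  destruct (H1 (eps / 2)) as [N1 P1]; [lra|]. destruct (H2 (eps / 2)) as [N2 P2]; [lra|].
  assert (E : forall n, Cpartial u n
    = (sum_f_R0 (fun n => fst (u n)) n, sum_f_R0 (fun n => snd (u n)) n)).
  { induction n as [|n IH]; simpl; [apply surjective_pairing|now rewrite IH]. }
  exists (max N1 N2). intros n Hn. rewrite E.
  specialize (P1 n ltac:(eapply Nat.le_trans; [apply Nat.le_max_l|exact Hn])).
  specialize (P2 n ltac:(eapply Nat.le_trans; [apply Nat.le_max_r|exact Hn])).
  unfold Rdist, Rminus in *.
  eapply Rle_lt_trans; [apply Cnorm_le_add_abs|]. simpl. lra.
Qed.

Lemma Series_tail (M : nat -> R) (eps : R) :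
  ex_series M -> 0 < eps -> exists N, forall n, (N <= n)%nat ->
    Series (fun k => M (S n + k)%nat) < eps.
Proof.
  intros HM He. pose proof (Series_correct _ HM) as H. apply is_series_Reals in H.
  destruct (H eps He) as [N HN]. exists N. intros n Hn. specialize (HN n Hn).
  rewrite (Series_incr_n M (S n) (Nat.lt_0_succ n) HM) in HN.
  unfold Rdist in HN. simpl Init.Nat.pred in HN.
  pose proof (Rle_abs (- (sum_f_R0 M n - (sum_f_R0 M n + Series (fun k => M (S n + k)%nat))))) as A.
  rewrite Rabs_Ropp in A. lra.
Qed.

Lemma Series_tail_bound (a M : nat -> R) (n : nat) :
  ex_series M -> (forall k, Rabs (a k) <= M k) ->
  Rabs (Series a - sum_f_R0 a n) <= Series (fun k => M (S n + k)%nat).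
Proof.
  intros HM H.
  assert (Ha : ex_series a).
  { apply (ex_series_le (V := R_CompleteNormedModule) _ M); [exact H|exact HM]. }
  assert (HM' : ex_series (fun k => M (S n + k)%nat)) by now apply ex_series_incr_n.
  rewrite (Series_incr_n a (S n) (Nat.lt_0_succ n) Ha). simpl Init.Nat.pred.
  replace (_ - _) with (Series (fun k => a (S n + k)%nat)) by ring.
  eapply Rle_trans.
  - apply Series_Rabs. apply (ex_series_le (V := R_CompleteNormedModule) _ (fun k => M (S n + k)%nat)); [|exact HM'].
    intros k. unfold norm; simpl. unfold abs; simpl. rewrite Rabs_Rabsolu. apply H.
  - apply Series_le; [|exact HM']. intros k. split; [apply Rabs_pos|apply H].
Qed.

(** Tannery's theorem. Beyond a fixed index both tails are below eps / 3 by the majorant, and the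
    finite sum before it converges term by term. The arbitrary filter lets one proof serve the
    limits at infinity and at 0 from the right. *)
Lemma Series_dominated {T : Type} (F : (T -> Prop) -> Prop) {FF : Filter F}
    (a : nat -> T -> R) (l : nat -> R) (M : nat -> R) :
  ex_series M -> F (fun x => forall n, Rabs (a n x) <= M n) -> (forall n, Rabs (l n) <= M n) ->
  (forall n eps, 0 < eps -> F (fun x => Rabs (a n x - l n) < eps)) ->
  forall eps, 0 < eps -> F (fun x => Rabs (Series (fun n => a n x) - Series l) < eps).
Proof.
  intros HM Ha Hl H eps He.
  destruct (Series_tail M (eps / 3) HM ltac:(lra)) as [N HN].
  specialize (HN N (le_n N)).
  assert (P : forall m e, 0 < e ->
    F (fun x => Rabs (sum_f_R0 (fun n => a n x) m - sum_f_R0 l m) < e)).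
  { induction m as [|m IH]; intros e Hpe; simpl; [now apply H|].
    assert (He2 : 0 < e / 2) by lra.
    generalize (filter_and _ _ (IH _ He2) (H (S m) _ He2)).
    apply filter_imp. intros x [H1 H2].
    replace (_ - _) with ((sum_f_R0 (fun n => a n x) m - sum_f_R0 l m) + (a (S m) x - l (S m))) by ring.
    eapply Rle_lt_trans; [apply Rabs_triang|lra]. }
  generalize (filter_and _ _ Ha (P N (eps / 3) ltac:(lra))). apply filter_imp.
  intros x [H1 H2].
  pose proof (Series_tail_bound _ M N HM H1) as B1.
  pose proof (Series_tail_bound _ M N HM Hl) as B2.
  apply Rabs_def2 in H2. apply Rabs_def1;
    apply Rabs_le_between in B1; apply Rabs_le_between in B2; lra.
Qed.

Lemma CSeries_dominated {T : Type} (F : (T -> Prop) -> Prop) {FF : Filter F}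
    (u : nat -> T -> Cplx) (l : nat -> Cplx) (M : nat -> R) :
  ex_series M -> F (fun x => forall n, Cnorm (u n x) <= M n) -> (forall n, Cnorm (l n) <= M n) ->
  (forall n eps, 0 < eps -> F (fun x => Cnorm (u n x - l n)%X < eps)) ->
  forall eps, 0 < eps -> F (fun x => Cnorm (CSeries (fun n => u n x) - CSeries l)%X < eps).
Proof.
  intros HM Hu Hl H eps He.
  assert (P1 : F (fun x => Rabs (Series (fun n => fst (u n x)) - Series (fun n => fst (l n))) < eps / 2)).
  { apply Series_dominated with M; auto; [| | |lra].
    - revert Hu; apply filter_imp. intros x Hx n. eapply Rle_trans; [apply Cnorm_fst|auto].
    - intros n. eapply Rle_trans; [apply Cnorm_fst|auto].
    - intros n e Hpe. generalize (H n e Hpe). apply filter_imp. intros x Hx.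
      eapply Rle_lt_trans; [|exact Hx]. apply (Cnorm_fst (u n x - l n)%X). }
  assert (P2 : F (fun x => Rabs (Series (fun n => snd (u n x)) - Series (fun n => snd (l n))) < eps / 2)).
  { apply Series_dominated with M; auto; [| | |lra].
    - revert Hu; apply filter_imp. intros x Hx n. eapply Rle_trans; [apply Cnorm_snd|auto].
    - intros n. eapply Rle_trans; [apply Cnorm_snd|auto].
    - intros n e Hpe. generalize (H n e Hpe). apply filter_imp. intros x Hx.
      eapply Rle_lt_trans; [|exact Hx]. apply (Cnorm_snd (u n x - l n)%X). }
  generalize (filter_and _ _ P1 P2). apply filter_imp. intros x [H1 H2].
  eapply Rle_lt_trans; [apply Cnorm_le_add_abs|]. simpl. unfold Rminus in *. lra.
Qed.

(** The majorant [M] makes the series of derivatives converge uniformly on the ball. The functions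
    themselves need only converge pointwise, so their convergence may rest on a different
    majorant. *)
Lemma is_derive_Series (a a' : nat -> R -> R) (M : nat -> R) (x : R) (r : posreal) :
  ex_series M ->
  (forall n y, Rabs (y - x) < r -> is_derive (a n) y (a' n y)) ->
  (forall n y, Rabs (y - x) < r -> continuous (a' n) y) ->
  (forall n y, Rabs (y - x) < r -> Rabs (a' n y) <= M n) ->
  (forall y, Rabs (y - x) < r -> ex_series (fun n => a n y)) ->
  is_derive (fun y => Series (fun n => a n y)) x (Series (fun n => a' n x)).
Proof.
  intros HM HD HC HB HS. apply is_derive_Reals.
  assert (U : CVU (fun n y => sum_f_R0 (fun k => a' k y) n) (fun y => Series (fun n => a' n y)) x r).
  { intros eps He. destruct (Series_tail M eps HM He) as [N HN]. exists N. intros n y Hn Hy.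
    eapply Rle_lt_trans; [|apply (HN n Hn)].
    apply Series_tail_bound; [exact HM|]. intros k. now apply HB. }
  apply (derivable_pt_lim_CVU (fun n y => sum_f_R0 (fun k => a k y) n)
    (fun n y => sum_f_R0 (fun k => a' k y) n) _ (fun y => Series (fun n => a' n y)) x x r).
  - unfold Boule. rewrite Rminus_diag, Rabs_R0. apply cond_pos.
  - intros y n Hy. induction n as [|n IH]; simpl.
    + apply is_derive_Reals, (HD 0%nat y Hy).
    + apply derivable_pt_lim_plus; [exact IH|]. apply is_derive_Reals, (HD (S n) y Hy).
  - intros y Hy. pose proof (Series_correct _ (HS y Hy)) as H. now apply is_series_Reals in H.
  - exact U.
  - apply (CVU_continuity _ _ _ _ U). intros n y Hy. induction n as [|n IH]; simpl.
    + apply continuity_pt_filterlim, (HC 0%nat y Hy).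
    + apply continuity_pt_plus; [exact IH|]. apply continuity_pt_filterlim, (HC (S n) y Hy).
Qed.

Lemma is_Cderive_CSeries (u u' : nat -> R -> Cplx) (M : nat -> R) (x : R) (r : posreal) :
  ex_series M ->
  (forall n y, Rabs (y - x) < r -> is_Cderive (u n) y (u' n y)) ->
  (forall n y, Rabs (y - x) < r -> Ccontinuous (u' n) y) ->
  (forall n y, Rabs (y - x) < r -> Cnorm (u' n y) <= M n) ->
  (forall y, Rabs (y - x) < r -> is_Cseries (fun n => u n y) (CSeries (fun n => u n y))) ->
  is_Cderive (fun y => CSeries (fun n => u n y)) x (CSeries (fun n => u' n x)).
Proof.
  intros HM HD HC HB HS; split; simpl.
  - apply (is_derive_Series (fun n y => fst (u n y)) (fun n y => fst (u' n y)) M x r HM).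
    + intros n y Hy. now apply HD.
    + intros n y Hy. now apply HC.
    + intros n y Hy. eapply Rle_trans; [apply Cnorm_fst|now apply HB].
    + intros y Hy. eexists. apply (HS y Hy).
  - apply (is_derive_Series (fun n y => snd (u n y)) (fun n y => snd (u' n y)) M x r HM).
    + intros n y Hy. now apply HD.
    + intros n y Hy. now apply HC.
    + intros n y Hy. eapply Rle_trans; [apply Cnorm_snd|now apply HB].
    + intros y Hy. eexists. apply (HS y Hy).
Qed.

(** * The binomial series *)

(** Kummer's test: the right-hand sides telescope, so eps times a partial sum from [N] on is at most
    p_N w_N. The remainder p w is carried along in the induction and dropped at the end, being
    nonnegative. *)
Lemma ex_series_Kummer (w p : nat -> R) (eps : R) (N : nat) :
  0 < eps -> (forall n, 0 <= w n) -> (forall n, 0 <= p n) ->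
  (forall n, (N <= n)%nat -> eps * w n <= p n * w n - p (S n) * w (S n)) ->
  ex_series w.
Proof.
  intros He Hw Hp H. apply (ex_series_incr_n w N).
  assert (B : forall m, eps * sum_n (fun k => w (N + k)%nat) m + p (N + S m)%nat * w (N + S m)%nat
    <= p N * w N).
  { induction m as [|m IH].
    - rewrite sum_O. specialize (H N (le_n N)).
      replace (N + 1)%nat with (S N) by lia. rewrite Nat.add_0_r. lra.
    - rewrite sum_Sn. unfold plus; simpl. specialize (H (N + S m)%nat (Nat.le_add_r _ _)).
      replace (N + S (S m))%nat with (S (N + S m)) by lia. lra. }
  apply (ex_finite_lim_seq_incr _ (p N * w N / eps)).
  - intros m. rewrite sum_Sn. unfold plus; simpl. specialize (Hw (N + S m)%nat). lra.
  - intros m. specialize (B m). apply Rle_div_r; [lra|].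
    pose proof (Rmult_le_pos _ _ (Hp (N + S m)%nat) (Hw (N + S m)%nat)) as Q.
    rewrite Rmult_comm. eapply Rle_trans; [|exact B]. rewrite <- Rplus_0_r at 1.
    apply Rplus_le_compat_l, Q.
Qed.

(** The coefficient of q^n in (1 - q)^(-v): the sign of the exponent is opposite to that in
    [sinh_pow]. *)
Definition binom_coef (v : Cplx) (n : nat) : Cplx := (poch v n / RtoC (INR (fact n)))%X.

Lemma RtoC_mul (x y : R) : RtoC (x * y) = (RtoC x * RtoC y)%X.
Proof. apply Cplx_eq; simpl; ring. Qed.

Lemma RtoC_add (x y : R) : RtoC (x + y) = (RtoC x + RtoC y)%X.
Proof. apply Cplx_eq; simpl; ring. Qed.

Lemma binom_coef_S (v : Cplx) (n : nat) :
  (RtoC (INR (S n)) * binom_coef v (S n) = (v + RtoC (INR n)) * binom_coef v n)%X.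
Proof.
  unfold binom_coef. rewrite fact_simpl, mult_INR, RtoC_mul. simpl poch.
  field. split; apply RtoC_neq_0; [apply INR_fact_neq_0|apply not_0_INR; lia].
Qed.

Lemma Cnorm_binom_coef_S (v : Cplx) (n : nat) :
  Cnorm (binom_coef v (S n)) = Cnorm (binom_coef v n) * Cnorm (v + RtoC (INR n)) / INR (S n).
Proof.
  assert (P : 0 < INR (S n)) by (apply lt_0_INR; lia).
  pose proof (f_equal Cnorm (binom_coef_S v n)) as E.
  rewrite !Cnorm_mul, Cnorm_RtoC, Rabs_pos_eq in E by lra.
  apply Rmult_eq_reg_l with (INR (S n)); [|lra]. rewrite E. field. lra.
Qed.

(** With p_n = n + 2 and W_n the general term, the recurrence gives p_(n+1) W_(n+1) = |v + n| W_n.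
    The Kummer difference is thus W_n (n + 2 - |v + n|), whose second factor tends to 2 - Re v > 0;
    half of this limit serves as [e]. *)
Lemma ex_series_binom_coef (v : Cplx) :
  Re v < 2 -> ex_series (fun n => Cnorm (binom_coef v n) / ((INR n + 1) * (INR n + 2))).
Proof.
  intros Hv. set (r := Re v) in *. set (e := (2 - r) / 2). assert (He : 0 < e) by (unfold e; lra).
  (* For n beyond [N], e (n + r) >= (Im v)^2. Since n + 2 - e = n + r + e, this yields |v + n|^2 =
     (n + r)^2 + (Im v)^2 <= (n + 2 - e)^2. *)
  destruct (INR_unbounded (Rabs r + Im v * Im v / e)) as [N HN].
  apply ex_series_Kummer with (p := fun n => INR n + 2) (eps := e) (N := N); auto.
  - intros n. pose proof (pos_INR n). apply Rdiv_le_0_compat; [apply Cnorm_ge_0|nra].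
  - intros n. pose proof (pos_INR n). lra.
  - intros n Hn. rewrite Cnorm_binom_coef_S, S_INR.
    pose proof (pos_INR n) as Pn. pose proof (le_INR _ _ Hn) as Hn'.
    assert (B : Cnorm (v + RtoC (INR n)) <= INR n + 2 - e).
    { assert (Hr : - r <= Rabs r) by (rewrite <- Rabs_Ropp; apply Rle_abs).
      assert (Hd : 0 <= Im v * Im v / e) by (apply Rdiv_le_0_compat; [nra|lra]).
      assert (Hd' : e * (Im v * Im v / e) = Im v * Im v) by (field; lra).
      rewrite <- (sqrt_Rsqr (INR n + 2 - e)) by (unfold e in *; lra).
      apply sqrt_le_1_alt. unfold Cnorm2; simpl.
      change (snd v) with (Im v). change (fst v) with r.
      replace (INR n + 2 - e) with (INR n + r + e) by (unfold e; field).
      assert (e * (Im v * Im v / e) <= e * (INR n + r)) by (apply Rmult_le_compat_l; lra).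
      unfold Rsqr. nra. }
    set (W := Cnorm (binom_coef v n) / ((INR n + 1) * (INR n + 2))).
    replace (_ - _) with (W * (INR n + 2 - Cnorm (v + RtoC (INR n)))) by (unfold W; field; lra).
    rewrite (Rmult_comm e). apply Rmult_le_compat_l; [|lra].
    apply Rdiv_le_0_compat; [apply Cnorm_ge_0|nra].
Qed.

(** The coefficients themselves vanish from some index on when v is a nonpositive integer, so the
    ratio test does not apply to them. It applies to the positive sequence T_n = (m)_n / n! with m =
    |v| + 1, where the added 1 keeps [m] positive at v = 0. *)
Lemma binom_coef_majorant (v : Cplx) :
  exists T : nat -> R, (forall n, Cnorm (binom_coef v n) <= T n) /\ CV_radius T = 1.
Proof.
  set (m := Cnorm v + 1). assert (Hm : 0 < m) by (unfold m; pose proof (Cnorm_ge_0 v); lra).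
  set (T := fix T n := match n with O => 1 | S k => T k * ((m + INR k) / INR (S k)) end).
  assert (TS : forall n, T (S n) = T n * ((m + INR n) / INR (S n))) by reflexivity.
  assert (TP : forall n, 0 < T n).
  { induction n as [|n IH]; [simpl; lra|]. rewrite TS. apply Rmult_lt_0_compat; [exact IH|].
    apply Rdiv_lt_0_compat; [pose proof (pos_INR n); lra|apply lt_0_INR; lia]. }
  exists T. split.
  - induction n as [|n IH].
    + unfold binom_coef. simpl. replace (1 / RtoC 1)%X with Cone.
      * rewrite Cnorm_1. lra.
      * change (RtoC 1) with Cone. field. change Cone with (RtoC 1). apply RtoC_neq_0. lra.
    + rewrite Cnorm_binom_coef_S, TS. unfold Rdiv. rewrite Rmult_assoc.
      apply Rmult_le_compat; [apply Cnorm_ge_0| |exact IH|].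
      * apply Rdiv_le_0_compat; [apply Cnorm_ge_0|apply lt_0_INR; lia].
      * apply Rmult_le_compat_r; [left; apply Rinv_0_lt_compat, lt_0_INR; lia|].
        eapply Rle_trans; [apply Cnorm_add|]. rewrite Cnorm_RtoC, Rabs_pos_eq by apply pos_INR.
        unfold m. lra.
  - replace (Finite 1) with (Finite (/ 1)) by (f_equal; field).
    apply CV_radius_finite_DAlembert; [intros n; apply Rgt_not_eq, TP|lra|].
    apply is_lim_seq_ext with (fun n => 1 + (m - 1) * / (INR (S n))).
    + intros n. rewrite TS. pose proof (TP n). pose proof (pos_INR n). rewrite S_INR.
      replace (T n * _ / T n) with ((m + INR n) / (INR n + 1)) by (field; lra).
      rewrite Rabs_pos_eq; [field; lra|]. apply Rdiv_le_0_compat; lra.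
    + replace (Finite 1) with (Finite (1 + (m - 1) * 0)) by (f_equal; ring).
      apply is_lim_seq_plus'; [apply is_lim_seq_const|].
      apply is_lim_seq_mult'; [apply is_lim_seq_const|].
      apply (is_lim_seq_incr_1 (fun n => / INR n)).
      apply (is_lim_seq_inv INR p_infty); [apply is_lim_seq_INR|discriminate].
Qed.

Lemma ex_series_binom_coef_geom (v : Cplx) (rho : R) :
  0 <= rho < 1 -> ex_series (fun n => Cnorm (binom_coef v n) * rho ^ n).
Proof.
  intros H. destruct (binom_coef_majorant v) as (T & HT & R1).
  apply (ex_series_le (V := R_CompleteNormedModule) _ (fun n => Rabs (T n * rho ^ n))).
  - intros n. unfold norm; simpl. unfold abs; simpl. rewrite !Rabs_mult.
    apply Rmult_le_compat_r; [apply Rabs_pos|].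
    rewrite Rabs_pos_eq by apply Cnorm_ge_0. eapply Rle_trans; [apply HT|apply Rle_abs].
  - apply CV_disk_inside. rewrite R1, Rabs_pos_eq by lra. simpl. lra.
Qed.

(** The formal derivative of a power series keeps its radius of convergence. At n = 0 the truncated
    exponent [pred n] is 0 and the factor [INR n] removes the term. *)
Lemma ex_series_binom_coef_geom_derive (v : Cplx) (rho : R) :
  0 <= rho < 1 -> ex_series (fun n => INR n * Cnorm (binom_coef v n) * rho ^ pred n).
Proof.
  intros H. destruct (binom_coef_majorant v) as (T & HT & R1).
  apply ex_series_incr_1.
  apply (ex_series_le (V := R_CompleteNormedModule) _ (fun n => Rabs (PS_derive T n * rho ^ n))).
  - intros n. unfold norm; simpl Init.Nat.pred. unfold PS_derive. simpl. unfold abs; simpl.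
    change (match n with | 0%nat => 1 | S _ => INR n + 1 end) with (INR (S n)).
    rewrite !Rabs_mult.
    apply Rmult_le_compat_r; [apply Rabs_pos|].
    apply Rmult_le_compat_l; [apply Rabs_pos|].
    rewrite (Rabs_pos_eq (Cnorm _)) by apply Cnorm_ge_0.
    eapply Rle_trans; [apply HT|apply Rle_abs].
  - apply CV_disk_inside. rewrite CV_radius_derive, R1, Rabs_pos_eq by lra. simpl. lra.
Qed.

Lemma Cnorm_Cpown (z : Cplx) (n : nat) : Cnorm (Cpown z n) = Cnorm z ^ n.
Proof.
  induction n as [|n IH]; simpl; [apply Cnorm_1|]. rewrite Cnorm_mul, IH. ring.
Qed.

Lemma is_Cseries_decr_1 (u : nat -> Cplx) (S : Cplx) :
  is_Cseries u S -> u O = 0%X -> is_Cseries (fun n => u (Datatypes.S n)) S.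
Proof.
  intros [H1 H2] E; split.
  - apply (is_series_incr_1 (fun n => fst (u n))). rewrite E. unfold plus; simpl. now rewrite Rplus_0_r.
  - apply (is_series_incr_1 (fun n => snd (u n))). rewrite E. unfold plus; simpl. now rewrite Rplus_0_r.
Qed.

Lemma CSeries_first (u : nat -> Cplx) : (forall n, u (S n) = 0%X) -> CSeries u = u O.
Proof.
  intros H.
  assert (G : forall a : nat -> R, (forall n, a (S n) = 0) -> is_series a (a O)).
  { intros a Ha. apply is_series_Reals. intros eps He. exists O. intros n _.
    replace (sum_f_R0 a n) with (a O).
    - unfold Rdist. now rewrite Rminus_diag, Rabs_R0.
    - induction n as [|n IH]; simpl; [reflexivity|]. rewrite <- IH, Ha. ring. }
  apply is_Cseries_unique; split.
  - apply (G (fun n => fst (u n))). intros n. now rewrite H.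
  - apply (G (fun n => snd (u n))). intros n. now rewrite H.
Qed.

Lemma binom_coef_0 (v : Cplx) : binom_coef v 0 = 1%X.
Proof.
  unfold binom_coef; simpl. change (RtoC 1) with Cone. field.
  change Cone with (RtoC 1). apply RtoC_neq_0. lra.
Qed.

Lemma Cpow_1_l (v : Cplx) : Cpow 1 v = 1%X.
Proof.
  unfold Cpow, Clog. rewrite Cnorm_1, ln_1. unfold Carg; simpl.
  destruct (Rlt_dec 0 1) as [_|H]; [|lra].
  rewrite Rdiv_0_l, atan_0. change (R0, R0) with Czero.
  replace (v * (0%R, 0%R))%X with 0%X by (apply Cplx_eq; simpl; ring). apply Cexp_0.
Qed.

Lemma is_derive_pow_R (n : nat) (x : R) : is_derive (fun y => y ^ n) x (INR n * x ^ pred n).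
Proof. auto_derive; [auto|ring]. Qed.

(* Along the ray [r * q], both sides of the binomial theorem solve the same linear ODE. *)
Theorem binomial_series (v q : Cplx) :
  Cnorm q < 1 -> (Cpow (1 - q) v * CSeries (fun n => binom_coef v n * Cpown q n) = 1)%X.
Proof.
  intros Hq. set (k := Cnorm q) in *. assert (Hk : 0 <= k) by apply Cnorm_ge_0.
  (* A ratio between |q| and 1. Two-sided derivatives are taken at both ends of [0, 1], so the
     parameter must be allowed to leave the segment; by at most (1 - k) / 2, which keeps k |y| below
     [rho]. *)
  set (rho := (1 + k) / 2).
  assert (Hrho : 0 <= rho < 1) by (unfold rho; lra).
  set (u := fun n (y : R) => (binom_coef v n * Cpown q n * RtoC (y ^ n))%X).
  set (u' := fun n (y : R) => (binom_coef v n * Cpown q n * RtoC (INR n * y ^ pred n))%X).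
  set (G := fun y => CSeries (fun n => u n y)).
  set (D := fun y => CSeries (fun n => u' n y)).
  set (H := fun y : R => Cpow (1 - RtoC y * q) v).
  assert (Bu : forall n y, k * Rabs y <= rho ->
    Cnorm (u n y) <= Cnorm (binom_coef v n) * rho ^ n).
  { intros n y Hy. unfold u. rewrite !Cnorm_mul, Cnorm_Cpown, Cnorm_RtoC, <- RPow_abs, Rmult_assoc.
    apply Rmult_le_compat_l; [apply Cnorm_ge_0|]. fold k. rewrite <- Rpow_mult_distr.
    apply pow_incr. split; [|exact Hy]. apply Rmult_le_pos; [exact Hk|apply Rabs_pos]. }
  assert (Bu' : forall n y, k * Rabs y <= rho ->
    Cnorm (u' n y) <= INR n * Cnorm (binom_coef v n) * rho ^ pred n).
  { intros n y Hy. unfold u'.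
    rewrite !Cnorm_mul, Cnorm_Cpown, Cnorm_RtoC, Rabs_mult, <- RPow_abs.
    rewrite (Rabs_pos_eq (INR n)) by apply pos_INR. fold k.
    destruct n as [|n]; [simpl; lra|]. simpl pred.
    replace (_ * _) with
      (INR (S n) * Cnorm (binom_coef v (S n)) * (k * (k * Rabs y) ^ n))
      by (rewrite Rpow_mult_distr; simpl; ring).
    apply Rmult_le_compat_l; [apply Rmult_le_pos; [apply pos_INR|apply Cnorm_ge_0]|].
    rewrite <- (Rmult_1_l (rho ^ n)).
    assert (0 <= k * Rabs y) by (apply Rmult_le_pos; [exact Hk|apply Rabs_pos]).
    apply Rmult_le_compat; [exact Hk|now apply pow_le|lra|now apply pow_incr]. }
  pose proof (ex_series_binom_coef_geom v rho Hrho) as S0.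
  pose proof (ex_series_binom_coef_geom_derive v rho Hrho) as S1.
  assert (Su : forall y, k * Rabs y <= rho -> is_Cseries (fun n => u n y) (G y)).
  { intros y Hy. apply (is_Cseries_of_bound _ _ S0). intros n. now apply Bu. }
  assert (Su' : forall y, k * Rabs y <= rho -> is_Cseries (fun n => u' n y) (D y)).
  { intros y Hy. apply (is_Cseries_of_bound _ _ S1). intros n. now apply Bu'. }
  assert (Hr : 0 < (1 - k) / 2) by lra. set (r := mkposreal _ Hr).
  assert (Near : forall x y, 0 <= x <= 1 -> Rabs (y - x) < r -> k * Rabs y <= rho).
  { intros x y Hx Hy. unfold r in Hy; simpl in Hy.
    pose proof (Rabs_triang (y - x) x) as Tr. replace (y - x + x)%R with y in Tr by ring.
    rewrite (Rabs_pos_eq x) in Tr by lra.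
    unfold rho. assert (k * Rabs y <= k * ((1 - k) / 2 + 1)) by (apply Rmult_le_compat_l; lra). nra. }
  assert (DG : forall x, 0 <= x <= 1 -> is_Cderive G x (D x)).
  { intros x Hx. apply (is_Cderive_CSeries u u' _ x r S1).
    - intros n y _. apply is_Cderive_scal, is_Cderive_RtoC_comp, is_derive_pow_R.
    - intros n y _.
      assert (C : exists l, is_Cderive (u' n) y l).
      { eexists. apply is_Cderive_scal, is_Cderive_RtoC_comp.
        apply is_derive_scal, is_derive_pow_R. }
      destruct C as [l C]. apply (is_Cderive_continuous _ _ _ C).
    - intros n y Hy. apply Bu', (Near x); auto.
    - intros y Hy. apply Su, (Near x); auto. }
  (* Since |q| < 1, the base of the power stays away from the branch cut along the whole segment. *)
  assert (Pos : forall x, 0 <= x <= 1 -> 0 < Re (1 - RtoC x * q)).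
  { intros x Hx. unfold Re; simpl. pose proof (Cnorm_fst q) as F. fold k in F.
    apply Rabs_le_between in F. nra. }
  (* The derivative series has no term at n = 0; reindexed from 1, the recurrence (n + 1) b_(n+1) =
     (v + n) b_n splits it as D = v q G + x q D. *)
  assert (ODE : forall x, 0 <= x <= 1 -> ((1 - RtoC x * q) * D x = v * q * G x)%X).
  { intros x Hx.
    assert (Hx' : k * Rabs x <= rho).
    { apply (Near x); [exact Hx|]. rewrite Rminus_diag, Rabs_R0. exact Hr. }
    assert (A1 : is_Cseries (fun n => u' (S n) x) (D x)).
    { apply (is_Cseries_decr_1 (fun n => u' n x)); [now apply Su'|]. unfold u'; simpl.
      rewrite Rmult_0_l. change (RtoC 0) with Czero. ring. }
    assert (A2 : is_Cseries (fun n => u' (S n) x) (v * q * G x + RtoC x * q * D x)).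
    { eapply is_Cseries_ext;
        [|exact (is_Cseries_add _ _ _ _ (is_Cseries_scal (v * q) _ _ (Su x Hx'))
          (is_Cseries_scal (RtoC x * q) _ _ (Su' x Hx')))].
      intros n. unfold u, u'. simpl pred. simpl Cpown.
      rewrite (RtoC_mul (INR (S n)) (x ^ n)).
      transitivity ((RtoC (INR (S n)) * binom_coef v (S n)) * Cpown q n * q * RtoC (x ^ n))%X;
        [rewrite binom_coef_S|ring].
      replace (RtoC x * q * (binom_coef v n * Cpown q n * RtoC (INR n * x ^ pred n)))%X
        with (RtoC (INR n) * q * binom_coef v n * Cpown q n * RtoC (x ^ n))%X; [ring|].
      destruct n as [|n]; [simpl; rewrite Rmult_0_l; change (RtoC 0) with Czero; ring|].
      simpl pred. rewrite RtoC_mul. change (x ^ S n) with (x * x ^ n). rewrite RtoC_mul. ring. }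
    apply is_Cseries_unique in A1. apply is_Cseries_unique in A2.
    rewrite A1 in A2. rewrite A2 at 1.
    replace (v * q * G x)%X with (v * q * G x + RtoC x * q * D x - RtoC x * q * D x)%X by ring.
    rewrite <- A2. ring. }
  assert (DH : forall x, 0 <= x <= 1 ->
    is_Cderive H x (v * (- q / (1 - RtoC x * q)) * H x)%X).
  { intros x Hx. unfold H, Cpow. apply is_Cderive_Cexp, is_Cderive_scal, is_Cderive_Clog; [|auto].
    apply is_Cderive_ext with (fun t => 1 + (- q) * RtoC t)%X; [intros t; ring|].
    eapply is_Cderive_eq.
    - apply is_Cderive_add; [apply is_Cderive_const|apply is_Cderive_scal, is_Cderive_RtoC].
    - ring. }
  (* The derivative of H G is H ((1 - x q) D - v q G) / (1 - x q), which the differential equation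
     makes zero. *)
  assert (E : (H 0%R * G 0%R = H 1%R * G 1%R)%X).
  { apply (Cconstant_of_derive_0 (fun x => H x * G x)%X); [|lra].
    intros x Hx. eapply is_Cderive_eq; [apply is_Cderive_mul; [now apply DH|now apply DG]|].
    assert (NZ : (1 - RtoC x * q)%X <> 0%X) by (apply Re_pos_neq_0; auto).
    transitivity (H x * ((1 - RtoC x * q) * D x - v * q * G x) / (1 - RtoC x * q))%X;
      [field; exact NZ|]. rewrite (ODE x Hx). field. exact NZ. }
  assert (E0 : (H 0%R * G 0%R = 1)%X).
  { unfold H, G. change (RtoC 0) with Czero. replace (1 - 0 * q)%X with 1%X by ring.
    rewrite Cpow_1_l, CSeries_first.
    - unfold u. rewrite binom_coef_0. simpl. change (RtoC 1) with Cone. ring.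
    - intros n. unfold u. simpl. rewrite Rmult_0_l. change (RtoC 0) with Czero. ring. }
  transitivity (H 1%R * G 1%R)%X; [|now rewrite <- E].
  unfold H, G. change (RtoC 1) with Cone. f_equal; [f_equal; ring|].
  apply CSeries_ext. intros n.
  unfold u. rewrite pow1. change (RtoC 1) with Cone. ring.
Qed.

(** * The integral of [sinh (w x) / sinh^v (c x)] *)

Lemma Re_le_Cnorm (z : Cplx) : Re z <= Cnorm z.
Proof. eapply Rle_trans; [apply Rle_abs|apply Cnorm_fst]. Qed.

Lemma exp_neg_le_inv (y : R) : 0 < y -> exp (- y) <= / y.
Proof.
  intros Hy. rewrite exp_Ropp. apply Rinv_le_contravar; [exact Hy|].
  pose proof (exp_ineq1 y). lra.
Qed.

Lemma exp_pow_INR (x : R) (n : nat) : exp x ^ n = exp (INR n * x).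
Proof.
  induction n as [|n IH]; [simpl; now rewrite Rmult_0_l, exp_0|].
  rewrite S_INR. simpl. rewrite IH, <- exp_plus. f_equal. ring.
Qed.

Lemma exp_le_compat (x y : R) : x <= y -> exp x <= exp y.
Proof. intros [H| ->]; [left; now apply exp_increasing|lra]. Qed.

(** The antiderivative of 2 exp(-mu x) sinh(w x) that vanishes at infinity, when both rates mu - w
    and mu + w have positive real part. Its value at 0 is -2 w / (mu^2 - w^2). *)
Definition Phi (mu w : Cplx) (x : R) : Cplx :=
  (Cexp (- (mu + w) * RtoC x) / (mu + w) - Cexp (- (mu - w) * RtoC x) / (mu - w))%X.

Lemma is_Cderive_Cexp_linear (z : Cplx) (x : R) :
  is_Cderive (fun t => Cexp (z * RtoC t)) x (z * Cexp (z * RtoC x))%X.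
Proof.
  apply is_Cderive_Cexp. eapply is_Cderive_eq.
  - apply is_Cderive_scal, is_Cderive_RtoC.
  - ring.
Qed.

Lemma is_Cderive_Phi (mu w : Cplx) (x : R) :
  (mu - w)%X <> 0%X -> (mu + w)%X <> 0%X ->
  is_Cderive (Phi mu w) x (Cexp (- (mu - w) * RtoC x) - Cexp (- (mu + w) * RtoC x))%X.
Proof.
  intros H1 H2.
  apply is_Cderive_ext with (fun t => / (mu + w) * Cexp (- (mu + w) * RtoC t)
    + - / (mu - w) * Cexp (- (mu - w) * RtoC t))%X.
  { intros t. unfold Phi. field. split; [exact H1|exact H2]. }
  eapply is_Cderive_eq.
  - apply is_Cderive_add; apply is_Cderive_scal, is_Cderive_Cexp_linear.
  - field. split; [exact H1|exact H2].
Qed.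

Lemma Cnorm_Cexp_linear (z : Cplx) (k x : R) :
  k <= Re z -> 0 <= x -> Cnorm (Cexp (- z * RtoC x)) <= exp (- (k * x)).
Proof.
  intros Hk Hx. rewrite Cnorm_Cexp. apply exp_le_compat. unfold Re in *; simpl. nra.
Qed.

(* Bounding the two terms separately only gives order [1 / k]; the gain comes from their
   difference. *)
Lemma Cnorm_Phi (mu w : Cplx) (k x : R) :
  0 < k -> k <= Re (mu - w) -> k <= Re (mu + w) -> 0 <= x ->
  Cnorm (Phi mu w x) <= 6 * Cnorm w / k ^ 2.
Proof.
  intros Hk HA HB Hx. unfold Phi.
  assert (NA : (mu - w)%X <> 0%X) by (apply Re_pos_neq_0; lra).
  assert (NB : (mu + w)%X <> 0%X) by (apply Re_pos_neq_0; lra).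
  set (eA := Cexp (- (mu - w) * RtoC x)). set (eB := Cexp (- (mu + w) * RtoC x)).
  (* The constant 6 is 4 + 2. The Lipschitz bound and x exp(-k x) <= 1 / k give |eB - eA| <= 4 |w| /
     k, divided once more by k; the second fraction is at most 2 |w| / k^2. *)
  replace (eB / (mu + w) - eA / (mu - w))%X
    with ((eB - eA) / (mu - w) + - (2 * w * eB / ((mu - w) * (mu + w))))%X
    by (rewrite RtoC_2; field; split; assumption).
  eapply Rle_trans; [apply Cnorm_add|]. rewrite Cnorm_opp.
  rewrite !Cnorm_div by (try apply Cmul_neq_0; assumption). rewrite !Cnorm_mul.
  rewrite Cnorm_RtoC, (Rabs_pos_eq 2) by lra.
  pose proof (Rle_trans _ _ _ HA (Re_le_Cnorm _)) as LA.
  pose proof (Rle_trans _ _ _ HB (Re_le_Cnorm _)) as LB.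
  pose proof (Cnorm_ge_0 w) as Pw.
  assert (E1 : Cnorm (eB - eA) <= 4 * Cnorm w / k).
  { eapply Rle_trans; [apply (Cexp_Lipschitz _ _ (- (k * x)))|].
    - unfold Re in *; simpl in *. nra.
    - unfold Re in *; simpl in *. nra.
    - replace (- (mu + w) * RtoC x - - (mu - w) * RtoC x)%X with (RtoC (-2) * (w * RtoC x))%X
        by (apply Cplx_eq; simpl; ring).
      rewrite !Cnorm_mul, !Cnorm_RtoC, (Rabs_pos_eq x), Rabs_left by lra.
      assert (G : x * exp (- (k * x)) <= / k).
      { destruct Hx as [Hx|<-].
        - apply Rmult_le_reg_l with k; [exact Hk|]. rewrite Rinv_r by lra.
          pose proof (exp_neg_le_inv (k * x) (Rmult_lt_0_compat _ _ Hk Hx)) as B.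
          apply (Rmult_le_compat_l (k * x)) in B; [|nra]. rewrite Rinv_r in B by nra. lra.
        - rewrite Rmult_0_l. left. now apply Rinv_0_lt_compat. }
      unfold Rdiv. apply (Rmult_le_compat_l (4 * Cnorm w)) in G; [|lra]. lra. }
  assert (E2 : Cnorm eB <= 1).
  { eapply Rle_trans; [now apply (Cnorm_Cexp_linear _ k)|].
    rewrite <- exp_0. apply exp_le_compat. nra. }
  assert (Pk : 0 < k ^ 2) by nra.
  replace (6 * Cnorm w / k ^ 2) with (4 * Cnorm w / k / k + 2 * Cnorm w / k ^ 2) by (field; lra).
  apply Rplus_le_compat; unfold Rdiv at 1.
  - unfold Rdiv at 2. apply Rmult_le_compat; [apply Cnorm_ge_0| |exact E1|].
    + left. apply Rinv_0_lt_compat. lra.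
    + apply Rinv_le_contravar; lra.
  - unfold Rdiv. apply Rmult_le_compat.
    + pose proof (Cnorm_ge_0 eB). nra.
    + left. apply Rinv_0_lt_compat. nra.
    + pose proof (Cnorm_ge_0 eB). nra.
    + apply Rinv_le_contravar; [exact Pk|]. nra.
Qed.

(** Each exponential is bounded separately, by exp(-k x) <= 1 / (k x). This suffices for the limit
    at infinity of a single term; uniformity in n comes from [Cnorm_Phi]. *)
Lemma Cnorm_Phi_decay (mu w : Cplx) (k x : R) :
  0 < k -> k <= Re (mu - w) -> k <= Re (mu + w) -> 0 < x ->
  Cnorm (Phi mu w x) <= 2 / (k ^ 2 * x).
Proof.
  intros Hk HA HB Hx. unfold Phi.
  assert (G : forall z : Cplx, k <= Re z -> Cnorm (Cexp (- z * RtoC x) / z) <= / (k ^ 2 * x)).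
  { intros z Hz. rewrite Cnorm_div by (apply Re_pos_neq_0; lra).
    replace (/ (k ^ 2 * x)) with (/ (k * x) * / k) by (field; lra).
    pose proof (Rle_trans _ _ _ Hz (Re_le_Cnorm _)) as L.
    apply Rmult_le_compat; [apply Cnorm_ge_0| | |].
    - left. apply Rinv_0_lt_compat. lra.
    - eapply Rle_trans; [apply (Cnorm_Cexp_linear _ k); lra|]. apply exp_neg_le_inv. nra.
    - apply Rinv_le_contravar; lra. }
  eapply Rle_trans; [apply Cnorm_sub|].
  pose proof (G _ HA). pose proof (G _ HB). unfold Rdiv. lra.
Qed.

Definition mode (v c : Cplx) (n : nat) : Cplx := (v * c + RtoC (2 * INR n) * c)%X.

Lemma Re_mode (v c w : Cplx) (k : R) (n : nat) :
  k <= Re (v * c + w) -> k + 2 * INR n * Re c <= Re (mode v c n + w).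
Proof. unfold mode, Re; simpl. nra. Qed.

(** The real parts grow by 2 Re c at each step. With [k] the least of this increment and the two
    values at n = 0, each is at least k + 2 n Re c >= k (n + 1). *)
Lemma mode_bounds (v c w : Cplx) :
  0 < Re c -> 0 < Re (v * c - w) -> 0 < Re (v * c + w) ->
  exists k, 0 < k /\ forall n,
    k * (INR n + 1) <= Re (mode v c n - w) /\ k * (INR n + 1) <= Re (mode v c n + w).
Proof.
  intros Hc H1 H2.
  exists (Rmin (2 * Re c) (Rmin (Re (v * c - w)) (Re (v * c + w)))).
  split; [apply Rmin_pos; [lra|now apply Rmin_pos]|]. intros n.
  set (k := Rmin _ _). pose proof (pos_INR n) as Pn.
  assert (K1 : k <= 2 * Re c) by apply Rmin_l.
  assert (K2 : k <= Re (v * c - w)) by (eapply Rle_trans; [apply Rmin_r|apply Rmin_l]).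
  assert (K3 : k <= Re (v * c + w)) by (eapply Rle_trans; [apply Rmin_r|apply Rmin_r]).
  pose proof (Re_mode v c w k n K3). pose proof (Re_mode v c (- w) k n K2) as Q.
  split; [eapply Rle_trans; [|exact Q]|]; nra.
Qed.

(** The binomial theorem at q = exp(-2 c x), which has modulus below 1 because Re c > 0 and x > 0;
    the factor 2^(-v) of the definition is inverted to 2^v. *)
Lemma sinh_pow_inv (c v : Cplx) (x : R) :
  0 < Re c -> 0 < x ->
  (/ sinh_pow c v x = Cpow 2 v * (Cexp (- (v * c) * RtoC x)
    * CSeries (fun n => binom_coef v n * Cpown (Cexp (- (2 * c) * RtoC x)) n)))%X.
Proof.
  intros Hc Hx. unfold sinh_pow.
  set (q := Cexp (- (2 * c) * RtoC x)).
  replace (Cexp (RtoC (-2) * (c * RtoC x))) with q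
    by (unfold q; f_equal; apply Cplx_eq; simpl; ring).
  assert (Hq : Cnorm q < 1).
  { unfold q. rewrite Cnorm_Cexp, <- exp_0. apply exp_increasing. unfold Re in *; simpl. nra. }
  pose proof (binomial_series v q Hq) as B.
  replace (- (v * c) * RtoC x)%X with (- (v * (c * RtoC x)))%X by ring.
  rewrite Cexp_opp.
  assert (E2 : Cpow 2 (- v) = (/ Cpow 2 v)%X).
  { unfold Cpow. rewrite <- Cexp_opp. f_equal. ring. }
  rewrite E2. set (S := CSeries _) in *.
  assert (N1 : Cpow 2 v <> 0%X) by apply Cexp_neq_0.
  assert (N2 : Cpow (1 - q) v <> 0%X) by apply Cexp_neq_0.
  assert (N3 : Cexp (v * (c * RtoC x)) <> 0%X) by apply Cexp_neq_0.
  replace S with (/ Cpow (1 - q) v)%X; [field; auto|].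
  transitivity (/ Cpow (1 - q) v * (Cpow (1 - q) v * S))%X; [rewrite B|]; field; exact N2.
Qed.

Lemma Cpown_Cexp (z : Cplx) (n : nat) : Cpown (Cexp z) n = Cexp (RtoC (INR n) * z).
Proof.
  induction n as [|n IH].
  - simpl. change (RtoC 0) with Czero. replace (0 * z)%X with 0%X by ring. now rewrite Cexp_0.
  - simpl Cpown. rewrite IH, <- Cexp_add, S_INR, RtoC_add. f_equal. change (RtoC 1) with Cone. ring.
Qed.

(** * Limits at the two ends and improper primitives *)

Definition vanishes (F : (R -> Prop) -> Prop) (f : R -> Cplx) : Prop :=
  forall eps, 0 < eps -> F (fun x => Cnorm (f x) < eps).

Lemma vanishes_add (F : (R -> Prop) -> Prop) {FF : Filter F} (f g : R -> Cplx) :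
  vanishes F f -> vanishes F g -> vanishes F (fun x => f x + g x)%X.
Proof.
  intros Hf Hg eps He. assert (He2 : 0 < eps / 2) by lra.
  generalize (filter_and _ _ (Hf _ He2) (Hg _ He2)). apply filter_imp. intros x [H1 H2].
  eapply Rle_lt_trans; [apply Cnorm_add|lra].
Qed.

Lemma vanishes_scal (F : (R -> Prop) -> Prop) {FF : Filter F} (z : Cplx) (f : R -> Cplx) :
  vanishes F f -> vanishes F (fun x => z * f x)%X.
Proof.
  intros Hf eps He. pose proof (Cnorm_ge_0 z) as Pz.
  assert (He2 : 0 < eps / (Cnorm z + 1)) by (apply Rdiv_lt_0_compat; lra).
  generalize (Hf _ He2). apply filter_imp. intros x H.
  rewrite Cnorm_mul. pose proof (Cnorm_ge_0 (f x)) as P.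
  apply Rlt_div_r in H; [|lra]. nra.
Qed.

Lemma vanishes_ext (F : (R -> Prop) -> Prop) {FF : Filter F} (f g : R -> Cplx) :
  (forall x, f x = g x) -> vanishes F f -> vanishes F g.
Proof.
  intros E Hf eps He. generalize (Hf _ He). apply filter_imp. intros x. now rewrite E.
Qed.

(** The primitive is normalised to vanish at infinity, so its limit at 0 is [- I] and the integral
    is 0 - (- I). In this form linear combinations of integrals are combinations of primitives. *)
Definition has_improper_primitive (g : R -> Cplx) (I : Cplx) : Prop :=
  exists F : R -> Cplx,
    (forall x, 0 < x -> is_Cderive F x (g x)) /\
    vanishes (Rbar_locally p_infty) F /\ vanishes (at_right 0) (fun x => F x + I)%X.

(** The primitive is the sum of the terms [Phi]. Two majorants are at work: [M], valid for all x >=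
    0 and summable because Re v < 2, controls the values up to both ends; a geometric one, valid
    near each x > 0, justifies differentiation term by term. *)
Lemma sinh_primitive (v c w : Cplx) :
  Re v < 2 -> 0 < Re c -> 0 < Re (v * c - w) -> 0 < Re (v * c + w) ->
  has_improper_primitive (fun x => Csinh (w * RtoC x) / sinh_pow c v x)%X
    (Cpow 2 v * CSeries (fun n => binom_coef v n
      * (w / ((mode v c n - w) * (mode v c n + w)))))%X.
Proof.
  intros Hv Hc H1 H2.
  destruct (mode_bounds v c w Hc H1 H2) as (k & Hk & Hmode).
  assert (NA : forall n, (mode v c n - w)%X <> 0%X).
  { intros n. apply Re_pos_neq_0. destruct (Hmode n) as [Q _]. pose proof (pos_INR n). nra. }
  assert (NB : forall n, (mode v c n + w)%X <> 0%X).
  { intros n. apply Re_pos_neq_0. destruct (Hmode n) as [_ Q]. pose proof (pos_INR n). nra. }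
  set (u := fun n x => (binom_coef v n * Phi (mode v c n) w x)%X).
  set (u' := fun n x => (binom_coef v n * (Cexp (- (mode v c n - w) * RtoC x)
    - Cexp (- (mode v c n + w) * RtoC x)))%X).
  (* Twice the 6 of [Cnorm_Phi], since 1 / (n + 1)^2 <= 2 / ((n + 1)(n + 2)). *)
  set (M := fun n => 12 * Cnorm w / k ^ 2
    * (Cnorm (binom_coef v n) / ((INR n + 1) * (INR n + 2)))).
  assert (HM : ex_series M).
  { apply (ex_series_scal_l (K := R_AbsRing) (V := R_NormedModule)).
    now apply ex_series_binom_coef. }
  assert (Bu : forall n x, 0 <= x -> Cnorm (u n x) <= M n).
  { intros n x Hx. unfold u, M. rewrite Cnorm_mul. pose proof (pos_INR n) as Pn.
    destruct (Hmode n) as [Q1 Q2].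
    replace (_ * (_ / _)) with (Cnorm (binom_coef v n)
      * (12 * Cnorm w / (k ^ 2 * ((INR n + 1) * (INR n + 2))))) by (field; nra).
    apply Rmult_le_compat_l; [apply Cnorm_ge_0|].
    eapply Rle_trans; [apply (Cnorm_Phi _ _ (k * (INR n + 1))); auto; nra|].
    replace (12 * Cnorm w / _)
      with (6 * Cnorm w / (k * (INR n + 1)) ^ 2 * (2 * (INR n + 1) / (INR n + 2))) by (field; nra).
    rewrite <- Rmult_1_r at 1. apply Rmult_le_compat_l.
    - apply Rdiv_le_0_compat; [pose proof (Cnorm_ge_0 w); lra|nra].
    - apply Rle_div_r; lra. }
  set (F := fun x => CSeries (fun n => u n x)).
  assert (DF : forall x, 0 < x -> is_Cderive F x (CSeries (fun n => u' n x))).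
  { intros x Hx. assert (Hr : 0 < x / 2) by lra.
    (* In the ball of radius x / 2 around x every point exceeds x / 2, so both exponentials of index
       n are at most rho^n. *)
    set (rho := exp (- (k * (x / 2)))).
    assert (Hrho : 0 <= rho < 1).
    { split; [left; apply exp_pos|]. unfold rho. rewrite <- exp_0. apply exp_increasing. nra. }
    assert (Near : forall y, Rabs (y - x) < mkposreal _ Hr -> x / 2 < y).
    { intros y Hy. apply Rabs_def2 in Hy. simpl in Hy. lra. }
    apply (is_Cderive_CSeries u u' (fun n => 2 * (Cnorm (binom_coef v n) * rho ^ n)) x
      (mkposreal _ Hr)).
    - apply (ex_series_scal_l (K := R_AbsRing) (V := R_NormedModule)).
      now apply ex_series_binom_coef_geom.
    - intros n y _. now apply is_Cderive_scal, is_Cderive_Phi.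
    - intros n y _. eapply is_Cderive_continuous. apply is_Cderive_scal.
      apply is_Cderive_ext with (fun t => Cexp (- (mode v c n - w) * RtoC t)
        + (- (1)) * Cexp (- (mode v c n + w) * RtoC t))%X; [intros t; ring|].
      apply is_Cderive_add; [|apply is_Cderive_scal]; apply is_Cderive_Cexp_linear.
    - intros n y Hy. apply Near in Hy. unfold u'. rewrite Cnorm_mul. destruct (Hmode n) as [Q1 Q2].
      pose proof (pos_INR n) as Pn.
      assert (E : forall z, k * (INR n + 1) <= Re z -> Cnorm (Cexp (- z * RtoC y)) <= rho ^ n).
      { intros z Hz. eapply Rle_trans; [apply (Cnorm_Cexp_linear _ _ _ Hz); lra|].
        unfold rho. rewrite exp_pow_INR. apply exp_le_compat.
        enough (k * (x / 2) * INR n <= k * (INR n + 1) * y) by lra.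
        assert (k * INR n * (x / 2) <= k * INR n * y) by (apply Rmult_le_compat_l; nra). nra. }
      pose proof (E _ Q1) as E1. pose proof (E _ Q2) as E2.
      eapply Rle_trans; [apply Rmult_le_compat_l; [apply Cnorm_ge_0|apply Cnorm_sub]|].
      pose proof (Cnorm_ge_0 (binom_coef v n)). nra.
    - intros y Hy. apply Near in Hy. apply (is_Cseries_of_bound _ _ HM). intros n. apply Bu. lra. }
  (* The factor 2^v comes from the inverse of the power of sinh, the 1/2 from sinh as a
     half-difference of exponentials. *)
  exists (fun x => Cpow 2 v / 2 * F x)%X. split; [|split].
  - intros x Hx. eapply is_Cderive_eq; [apply is_Cderive_scal; now apply DF|].
    unfold Cdiv at 2. rewrite (sinh_pow_inv c v x Hc Hx).
    set (q := Cexp (- (2 * c) * RtoC x)).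
    assert (Hq : Cnorm q < 1).
    { unfold q. rewrite Cnorm_Cexp, <- exp_0. apply exp_increasing. unfold Re in *; simpl. nra. }
    set (E := (Cexp (- (v * c) * RtoC x) * (Cexp (w * RtoC x) - Cexp (- (w * RtoC x))))%X).
    replace (CSeries (fun n => u' n x)) with (E * CSeries (fun n => binom_coef v n * Cpown q n))%X.
    + unfold Csinh, E. field. apply RtoC_neq_0. lra.
    + symmetry. apply is_Cseries_unique.
      apply is_Cseries_ext with (fun n => E * (binom_coef v n * Cpown q n))%X.
      * intros n. unfold u', E, q, mode. rewrite Cpown_Cexp.
        replace (- (v * c + RtoC (2 * INR n) * c - w) * RtoC x)%X
          with (- (v * c) * RtoC x + (RtoC (INR n) * (- (2 * c) * RtoC x) + w * RtoC x))%X
          by (rewrite RtoC_mul; ring).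
        replace (- (v * c + RtoC (2 * INR n) * c + w) * RtoC x)%X
          with (- (v * c) * RtoC x + (RtoC (INR n) * (- (2 * c) * RtoC x) + - (w * RtoC x)))%X
          by (rewrite RtoC_mul; ring).
        rewrite !Cexp_add. ring.
      * apply is_Cseries_scal.
        apply (is_Cseries_of_bound _ (fun n => Cnorm (binom_coef v n) * Cnorm q ^ n)).
        -- apply ex_series_binom_coef_geom. split; [apply Cnorm_ge_0|exact Hq].
        -- intros n. rewrite Cnorm_mul, Cnorm_Cpown. lra.
  - apply vanishes_scal; [apply Rbar_locally_filter|]. intros eps He.
    (* The limit at infinity is written as the sum of the zero series, so that dominated convergence
       applies with termwise limit 0. *)
    assert (D : Rbar_locally p_infty (fun x => Cnorm (CSeries (fun n => u n x) - CSeries (fun _ => 0%X))%X < eps)).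
    { apply CSeries_dominated with M; auto; [apply Rbar_locally_filter| | |].
      - exists 0. intros x Hx n. apply Bu. lra.
      - intros n. rewrite Cnorm_0. eapply Rle_trans; [apply Cnorm_ge_0|apply (Bu n 0); lra].
      - intros n e Hpe. destruct (Hmode n) as [Q1 Q2]. pose proof (pos_INR n) as Pn.
        set (C := Cnorm (binom_coef v n) * (2 / (k * (INR n + 1)) ^ 2)).
        assert (PC : 0 <= C).
        { apply Rmult_le_pos; [apply Cnorm_ge_0|]. apply Rdiv_le_0_compat; nra. }
        exists (C / e). intros x Hx.
        assert (Px : 0 < x) by (eapply Rle_lt_trans; [|exact Hx]; apply Rdiv_le_0_compat; lra).
        replace (u n x - 0)%X with (u n x) by ring. unfold u. rewrite Cnorm_mul.
        eapply Rle_lt_trans; [apply Rmult_le_compat_l; [apply Cnorm_ge_0|]|].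
        + apply (Cnorm_Phi_decay _ _ (k * (INR n + 1))); auto. nra.
        + apply Rlt_div_l in Hx; [|exact Hpe].
          replace (_ * (2 / _)) with (C / x) by (unfold C; field; nra).
          apply Rlt_div_l; [exact Px|]. lra. }
    revert D. apply filter_imp. intros x.
    rewrite (CSeries_first (fun _ => 0%X)) by reflexivity.
    now replace (CSeries (fun n => u n x) - 0)%X with (F x) by (unfold F; ring).
  (* The series also converges at x = 0, by [M], and [Phi] at 0 gives (2^v / 2) F(0) = - I. The
     limit to be proved is therefore right continuity of [F] at 0. *)
  - apply vanishes_ext with (fun x => Cpow 2 v / 2 * (F x - F 0%R))%X; [apply at_right_proper_filter| |].
    { intros x. assert (E : is_Cseries (fun n => u n 0) (F 0)).
      { apply (is_Cseries_of_bound _ _ HM). intros n. apply Bu. lra. }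
      apply (is_Cseries_scal (- / 2)) in E.
      apply is_Cseries_ext with (w := fun n => (binom_coef v n
        * (w / ((mode v c n - w) * (mode v c n + w))))%X) in E.
      - rewrite (is_Cseries_unique _ _ E). field. apply RtoC_neq_0. lra.
      - intros n. unfold u, Phi. change (RtoC 0) with Czero.
        replace (- (mode v c n + w) * 0)%X with 0%X by ring.
        replace (- (mode v c n - w) * 0)%X with 0%X by ring.
        rewrite Cexp_0, RtoC_2. field.
        repeat split; auto. intros X. apply (f_equal fst) in X. simpl in X. lra. }
    apply vanishes_scal; [apply at_right_proper_filter|]. intros eps He.
    apply (CSeries_dominated (at_right 0) u (fun n => u n 0%R) M); auto.
    + exists (mkposreal 1 Rlt_0_1). intros x _ Hx n. apply Bu. lra.
    + intros n. apply Bu. lra.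
    + intros n e Hpe.
      assert (L : locally 0 (fun x => Cnorm (u n x - u n 0%R) < e)).
      { apply Ccontinuous_norm; [|exact Hpe]. eapply is_Cderive_continuous.
        now apply is_Cderive_scal, is_Cderive_Phi. }
      destruct L as [r L]. exists r. intros y Hy _. exact (L y Hy).
Qed.

(** * The integral as a hypergeometric series *)

(** The fundamental theorem of calculus as an equivalence: existence of the integral on [x, y] uses
    one direction, and the other identifies an arbitrary value [J] over which the improper integral
    quantifies. *)
Lemma C_integral_is_primitive (F f : R -> Cplx) (x y : R) :
  0 < x -> x <= y -> (forall t, 0 < t -> is_Cderive F t (f t)) ->
  (forall t, 0 < t -> Ccontinuous f t) ->
  forall J, C_integral_is f x y J <-> J = (F y - F x)%X.
Proof.
  intros Hx Hxy HD HC.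
  assert (I1 : is_RInt (fun t => fst (f t)) x y (fst (F y) - fst (F x))).
  { apply (is_RInt_derive (fun t => fst (F t)) (fun t => fst (f t)));
      rewrite Rmin_left, Rmax_right by exact Hxy; intros t Ht; [apply HD|apply HC]; lra. }
  assert (I2 : is_RInt (fun t => snd (f t)) x y (snd (F y) - snd (F x))).
  { apply (is_RInt_derive (fun t => snd (F t)) (fun t => snd (f t)));
      rewrite Rmin_left, Rmax_right by exact Hxy; intros t Ht; [apply HD|apply HC]; lra. }
  intros J. split.
  - intros (p1 & p2 & E1 & E2). rewrite <- RInt_Reals in E1, E2.
    rewrite (is_RInt_unique _ _ _ _ I1) in E1. rewrite (is_RInt_unique _ _ _ _ I2) in E2.
    apply Cplx_eq; simpl; lra.
  - intros ->.
    exists (ex_RInt_Reals_0 _ _ _ (ex_intro _ _ I1)), (ex_RInt_Reals_0 _ _ _ (ex_intro _ _ I2)).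
    rewrite <- !RInt_Reals. split; [now apply is_RInt_unique|now apply is_RInt_unique].
Qed.

(** The error F(y) - F(x) - I splits as F(y) - (F(x) + I), so the two cut-offs are chosen
    independently, with eps / 2 for each end. *)
Lemma improper_integral_primitive (f : R -> Cplx) (I : Cplx) :
  has_improper_primitive f I -> (forall t, 0 < t -> Ccontinuous f t) ->
  improper_integral_0_inf f I.
Proof.
  intros (F & HD & Hinf & H0) HC. split.
  - intros x y Hx Hxy. exists (F y - F x)%X.
    now apply (C_integral_is_primitive F f x y Hx Hxy HD HC).
  - intros eps He. assert (He2 : 0 < eps / 2) by lra.
    destruct (Hinf _ He2) as [M HM]. destruct (H0 _ He2) as [d Hd].
    exists d, M. split; [apply cond_pos|]. intros x y J Hx Hxd Hy Hxy HJ.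
    apply (C_integral_is_primitive F f x y Hx (Rlt_le _ _ Hxy) HD HC) in HJ. subst J.
    replace (F y - F x - I)%X with (F y - (F x + I))%X by ring.
    eapply Rle_lt_trans; [apply Cnorm_sub|].
    assert (B : ball 0 d x).
    { unfold ball; simpl; unfold AbsRing_ball, abs, minus, plus, opp; simpl.
      rewrite Ropp_0, Rplus_0_r, Rabs_pos_eq; lra. }
    specialize (Hd x B Hx). specialize (HM y Hy). simpl in Hd, HM. lra.
Qed.

(** The reciprocal of the power is a single exponential, exp(v log 2 - v c t - v Log(1 - exp(-2 c
    t))), so the integrand is a product of differentiable factors. The fundamental theorem for
    Riemann integrals asks for this continuity. *)
Lemma Ccontinuous_integrand (v a b c : Cplx) (x : R) :
  0 < Re c -> 0 < x ->
  Ccontinuous (fun t => Csinh (a * RtoC t) * Ccosh (b * RtoC t) / sinh_pow c v t)%X x.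
Proof.
  intros Hc Hx.
  set (q := fun t : R => (1 - Cexp (- (2 * c) * RtoC t))%X).
  set (L := (v * Clog 2)%X).
  enough (E : exists l, is_Cderive (fun t => (Cexp (a * RtoC t) + (- (1)) * Cexp (- a * RtoC t)) / 2
    * ((Cexp (b * RtoC t) + Cexp (- b * RtoC t)) / 2)
    * Cexp (L + (- (v * c) * RtoC t + (- v) * Clog (q t))))%X x l).
  { destruct E as [l E]. apply (is_Cderive_continuous _ _ l). revert E.
    apply is_Cderive_ext. intros t. unfold Csinh, Ccosh.
    replace (- (a * RtoC t))%X with (- a * RtoC t)%X by ring.
    replace (- (b * RtoC t))%X with (- b * RtoC t)%X by ring.
    assert (E : (sinh_pow c v t * Cexp (L + (- (v * c) * RtoC t + - v * Clog (q t))) = 1)%X).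
    { unfold sinh_pow, Cpow.
      replace (1 - Cexp (RtoC (-2) * (c * RtoC t)))%X with (q t)
        by (unfold q; do 2 f_equal; apply Cplx_eq; simpl; ring).
      rewrite <- !Cexp_add, <- Cexp_0. f_equal. unfold L. ring. }
    assert (N : sinh_pow c v t <> 0%X).
    { intros Z. rewrite Z in E. apply (f_equal Cnorm) in E. rewrite Cnorm_mul, Cnorm_0, Cnorm_1 in E. lra. }
    set (X := Cexp (L + _)) in *. replace X with (/ sinh_pow c v t)%X.
    - field. split; [apply RtoC_neq_0; lra|exact N].
    - transitivity (/ sinh_pow c v t * (sinh_pow c v t * X))%X; [rewrite E|]; field; exact N. }
  assert (Hq : 0 < Re (q x)).
  { unfold q. set (e := Cexp _). assert (B : Cnorm e < 1).
    { unfold e. rewrite Cnorm_Cexp, <- exp_0. apply exp_increasing. unfold Re in *; simpl. nra. }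
    pose proof (Re_le_Cnorm e). unfold Re in *; simpl in *. lra. }
  assert (Dexp : forall z : Cplx, is_Cderive (fun t => Cexp (z * RtoC t)) x (z * Cexp (z * RtoC x))%X)
    by (intros z; apply is_Cderive_Cexp_linear).
  eexists. apply is_Cderive_mul; [apply is_Cderive_mul|].
  - apply is_Cderive_mul; [|apply is_Cderive_const].
    apply is_Cderive_add; [|apply is_Cderive_scal]; apply Dexp.
  - apply is_Cderive_mul; [|apply is_Cderive_const]. apply is_Cderive_add; apply Dexp.
  - apply is_Cderive_Cexp. apply is_Cderive_add; [apply is_Cderive_const|].
    apply is_Cderive_add; [apply is_Cderive_scal, is_Cderive_RtoC|].
    apply is_Cderive_scal, is_Cderive_Clog; [|exact Hq].
    apply is_Cderive_ext with (fun t => 1 + (- (1)) * Cexp (- (2 * c) * RtoC t))%X;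
      [intros t; unfold q; ring|].
    apply is_Cderive_add; [apply is_Cderive_const|apply is_Cderive_scal, Dexp].
Qed.

Lemma has_improper_primitive_half_add (f g h : R -> Cplx) (I J K : Cplx) :
  has_improper_primitive f I -> has_improper_primitive g J ->
  (forall x, h x = (/ 2 * (f x + g x))%X) -> K = (/ 2 * (I + J))%X -> has_improper_primitive h K.
Proof.
  intros (F & F1 & F2 & F3) (G & G1 & G2 & G3) Eh ->.
  exists (fun x => / 2 * (F x + G x))%X. split; [|split].
  - intros x Hx. rewrite Eh. apply is_Cderive_scal, is_Cderive_add; auto.
  - apply vanishes_scal; [apply Rbar_locally_filter|].
    apply vanishes_add; auto. apply Rbar_locally_filter.
  - apply vanishes_ext with (fun x => / 2 * ((F x + I) + (G x + J)))%X;
      [apply within_filter, locally_filter|intros x; ring|].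
    apply vanishes_scal; [apply within_filter, locally_filter|].
    apply vanishes_add; auto. apply within_filter, locally_filter.
Qed.

(** * Algebra of the integrand and of the hypergeometric terms *)

Lemma Csinh_mul_Ccosh (z w : Cplx) :
  (Csinh z * Ccosh w = / 2 * (Csinh (z + w) + Csinh (z - w)))%X.
Proof.
  unfold Csinh, Ccosh.
  replace (- (z + w))%X with (- z + - w)%X by ring.
  replace (- (z - w))%X with (- z + w)%X by ring. unfold Csub at 2.
  rewrite !Cexp_add, RtoC_2.
  replace (z - w)%X with (z + - w)%X by ring. rewrite !Cexp_add.
  field. intros X. apply (f_equal fst) in X. simpl in X. lra.
Qed.

(** The quotient (1 + z)_n / (z)_n = (z + n) / z, cleared of denominators so that it holds for every
    z. It collapses each pair of neighbouring parameters to a linear factor in n. *)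
Lemma poch_1_add (z : Cplx) (n : nat) : (z * poch (1 + z) n = poch z n * (z + RtoC (INR n)))%X.
Proof.
  induction n as [|n IH].
  - simpl. change (RtoC 0) with Czero. ring.
  - simpl poch. transitivity (z * poch (1 + z) n * (1 + z + RtoC (INR n)))%X; [ring|].
    rewrite IH, S_INR, RtoC_add. change (RtoC 1) with Cone. ring.
Qed.

Lemma poch_neq_0 (z : Cplx) (n : nat) :
  (forall k, (z + RtoC (INR k))%X <> 0%X) -> poch z n <> 0%X.
Proof.
  intros H. induction n as [|n IH]; simpl.
  - intros X. apply (f_equal fst) in X. simpl in X. lra.
  - now apply Cmul_neq_0.
Qed.

Lemma not_in_Z0neg (z : Cplx) (n : nat) : ~ in_Z0neg z -> (z + RtoC (INR n))%X <> 0%X.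
Proof.
  intros H E. apply H. exists n. apply Cplx_eq; [apply (f_equal fst) in E|apply (f_equal snd) in E];
    simpl in *; lra.
Qed.

Lemma Cpown_1 (n : nat) : Cpown 1 n = 1%X.
Proof. induction n as [|n IH]; simpl; [reflexivity|]. rewrite IH. ring. Qed.

(** A pair 1 + s over s contributes (s + n) / s, a pair s over 1 + s the inverse. Of the seven upper
    parameters only v keeps its Pochhammer symbol, which with n! forms the binomial coefficient. *)
Lemma hyp_term_very_well_poised (v s1 s2 s3 s4 s5 s6 : Cplx) (n : nat) :
  (forall k, (s1 + RtoC (INR k))%X <> 0%X) -> (forall k, (s2 + RtoC (INR k))%X <> 0%X) ->
  (forall k, (s3 + RtoC (INR k))%X <> 0%X) -> (forall k, (s4 + RtoC (INR k))%X <> 0%X) ->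
  (forall k, (s5 + RtoC (INR k))%X <> 0%X) -> (forall k, (s6 + RtoC (INR k))%X <> 0%X) ->
  (hyp_term [v; 1 + s1; 1 + s2; s3; s4; s5; s6] [s1; s2; 1 + s3; 1 + s4; 1 + s5; 1 + s6] 1 n
  = binom_coef v n * (s3 * s4 * s5 * s6 / (s1 * s2))
    * ((s1 + RtoC (INR n)) * (s2 + RtoC (INR n))
      / ((s3 + RtoC (INR n)) * (s4 + RtoC (INR n)) * (s5 + RtoC (INR n)) * (s6 + RtoC (INR n)))))%X.
Proof.
  intros H1 H2 H3 H4 H5 H6.
  assert (Z : forall s : Cplx, (forall k, (s + RtoC (INR k))%X <> 0%X) -> s <> 0%X).
  { intros s H E. apply (H 0%nat). rewrite E. simpl. change (RtoC 0) with Czero. ring. }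
  assert (P1 : forall s : Cplx, (forall k, (s + RtoC (INR k))%X <> 0%X) ->
    (poch (1 + s) n = poch s n * (s + RtoC (INR n)) / s)%X).
  { intros s H. rewrite <- poch_1_add. field. now apply Z. }
  unfold hyp_term, prod_poch, binom_coef; simpl fold_right.
  rewrite !P1 by assumption. rewrite Cpown_1. field.
  repeat split; auto using poch_neq_0.
  apply RtoC_neq_0, INR_fact_neq_0.
Qed.

(** * Absolute convergence of the series with terms of order n^(-2) *)

Lemma is_Cseries_binom_coef (v : Cplx) (u : nat -> Cplx) (C : R) :
  Re v < 2 -> (forall n, Cnorm (u n) <= C / ((INR n + 1) * (INR n + 2))) ->
  is_Cseries (fun n => binom_coef v n * u n)%X (CSeries (fun n => binom_coef v n * u n)%X).
Proof.
  intros Hv H.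
  apply is_Cseries_of_bound
    with (fun n => C * (Cnorm (binom_coef v n) / ((INR n + 1) * (INR n + 2)))).
  - apply (ex_series_scal_l (K := R_AbsRing) (V := R_NormedModule)).
    now apply ex_series_binom_coef.
  - intros n. rewrite Cnorm_mul. unfold Rdiv in *.
    pose proof (Rmult_le_compat_l _ _ _ (Cnorm_ge_0 (binom_coef v n)) (H n)). lra.
Qed.

(** Both factors have modulus at least k (n + 1); the 2 in the constant again trades (n + 1)^2 for
    (n + 1)(n + 2). *)
Lemma mode_inv_bound (v c w : Cplx) :
  0 < Re c -> 0 < Re (v * c - w) -> 0 < Re (v * c + w) ->
  exists C, 0 <= C /\ forall n, Cnorm (/ ((mode v c n - w) * (mode v c n + w)))
    <= C / ((INR n + 1) * (INR n + 2)).
Proof.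
  intros Hc H1 H2. destruct (mode_bounds v c w Hc H1 H2) as (k & Hk & Hm).
  assert (Pk : 0 < k * k) by nra.
  exists (2 / (k * k)). split; [apply Rdiv_le_0_compat; lra|].
  intros n. destruct (Hm n) as [Q1 Q2]. pose proof (pos_INR n) as Pn.
  assert (Pz : 0 < k * (INR n + 1)) by nra.
  rewrite Cnorm_inv, Cnorm_mul
    by (apply Cmul_neq_0; apply Re_pos_neq_0; eapply Rlt_le_trans; eassumption).
  pose proof (Rle_trans _ _ _ Q1 (Re_le_Cnorm _)) as L1.
  pose proof (Rle_trans _ _ _ Q2 (Re_le_Cnorm _)) as L2.
  apply Rle_trans with (/ (k * (INR n + 1) * (k * (INR n + 1)))).
  - apply Rinv_le_contravar; [nra|]. apply Rmult_le_compat; lra.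
  - replace (2 / (k * k) / _) with (/ (k * (INR n + 1) * (k * (INR n + 1)))
      * (2 * (INR n + 1) / (INR n + 2))) by (field; lra).
    rewrite <- Rmult_1_r at 1. apply Rmult_le_compat_l.
    + left. apply Rinv_0_lt_compat. nra.
    + apply Rle_div_r; lra.
Qed.

Theorem mainTheorem16 (v a b c s : Cplx)
  (hv : Re v < 2) (hc : 0 < Re c)
  (h1 : 0 < Re (Cadd (Cadd (Cmul v c) a) b))
  (h2 : 0 < Re (Csub (Cadd (Cmul v c) a) b))
  (h3 : 0 < Re (Cadd (Csub (Cmul v c) a) b))
  (h4 : 0 < Re (Csub (Csub (Cmul v c) a) b))
  (hs : Cmul s s = Csub (Cmul a a) (Cmul b b)) :
  let half_v := Cdiv v (RtoC 2) in
  let c2 := Cmul (RtoC 2) c in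
  let s1 := Csub half_v (Cdiv s c2) in
  let s2 := Cadd half_v (Cdiv s c2) in
  let s3 := Csub (Csub half_v (Cdiv a c2)) (Cdiv b c2) in
  let s4 := Cadd (Csub half_v (Cdiv a c2)) (Cdiv b c2) in
  let s5 := Cadd (Cadd half_v (Cdiv a c2)) (Cdiv b c2) in
  let s6 := Csub (Cadd half_v (Cdiv a c2)) (Cdiv b c2) in
  let P := Cmul (Cmul (Cmul (Csub (Csub (Cmul v c) a) b) (Cadd (Cadd (Cmul v c) a) b))
                      (Cadd (Csub (Cmul v c) a) b)) (Csub (Cadd (Cmul v c) a) b) in
  ~ in_Z0neg s1 -> ~ in_Z0neg s2 ->
  ~ in_Z0neg (Cadd Cone s3) -> ~ in_Z0neg (Cadd Cone s4) ->
  ~ in_Z0neg (Cadd Cone s5) -> ~ in_Z0neg (Cadd Cone s6) ->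
  exists I S : Cplx,
    improper_integral_0_inf
      (fun x => Cdiv (Cmul (Csinh (Cmul a (RtoC x))) (Ccosh (Cmul b (RtoC x))))
                     (sinh_pow c v x)) I /\
    Cseries_cv (hyp_term [v; Cadd Cone s1; Cadd Cone s2; s3; s4; s5; s6]
                         [s1; s2; Cadd Cone s3; Cadd Cone s4; Cadd Cone s5; Cadd Cone s6] Cone) S /\
    I = Cmul (Cdiv (Cmul (Cpow (RtoC 2) v)
                         (Cadd (Csub (Cmul (Cmul (Cmul v v) a) (Cmul c c)) (Cmul (Cmul a a) a))
                               (Cmul a (Cmul b b)))) P) S.
Proof.
  intros half_v c2 s1 s2 s3 s4 s5 s6 P Hs1 Hs2 _ _ _ _.
  (* In these variables the four half-plane conditions read Re(vc - w) > 0 and Re(vc + w) > 0 for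
     each w, and s^2 = a^2 - b^2 is the product w1 w2. *)
  set (w1 := (a + b)%X). set (w2 := (a - b)%X).
  assert (Q1 : 0 < Re (v * c - w1)).
  { replace (v * c - w1)%X with (v * c - a - b)%X by (unfold w1; ring). exact h4. }
  assert (Q2 : 0 < Re (v * c + w1)).
  { replace (v * c + w1)%X with (v * c + a + b)%X by (unfold w1; ring). exact h1. }
  assert (Q3 : 0 < Re (v * c - w2)).
  { replace (v * c - w2)%X with (v * c - a + b)%X by (unfold w2; ring). exact h3. }
  assert (Q4 : 0 < Re (v * c + w2)).
  { replace (v * c + w2)%X with (v * c + a - b)%X by (unfold w2; ring). exact h2. }
  assert (Nc : c <> 0%X) by now apply Re_pos_neq_0.
  assert (N2 : RtoC 2 <> 0%X) by (apply RtoC_neq_0; lra).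
  assert (Nc2 : c2 <> 0%X) by now apply Cmul_neq_0.
  set (mu := mode v c).
  assert (N : forall w : Cplx, 0 < Re (v * c + w) -> forall n, (mu n + w)%X <> 0%X).
  { intros w Hw n. apply Re_pos_neq_0. unfold mu.
    pose proof (Re_mode v c w _ n (Rle_refl _)). pose proof (pos_INR n). nra. }
  assert (NA1 : forall n, (mu n - w1)%X <> 0%X) by (intros n; apply (N (- w1)%X); exact Q1).
  assert (NB1 : forall n, (mu n + w1)%X <> 0%X) by (apply N; exact Q2).
  assert (NA2 : forall n, (mu n - w2)%X <> 0%X) by (intros n; apply (N (- w2)%X); exact Q3).
  assert (NB2 : forall n, (mu n + w2)%X <> 0%X) by (apply N; exact Q4).
  (* Division by 2 c turns the spacing 2 c of the exponents mu_n into 1, so each sigma_j + n is one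
     linear factor in mu_n. The powers of 2 c cancel in the term of the series. *)
  assert (Es : forall n, ((s1 + RtoC (INR n) = (mu n - s) / c2)
    /\ (s2 + RtoC (INR n) = (mu n + s) / c2)
    /\ (s3 + RtoC (INR n) = (mu n - w1) / c2)
    /\ (s4 + RtoC (INR n) = (mu n - w2) / c2)
    /\ (s5 + RtoC (INR n) = (mu n + w1) / c2)
    /\ (s6 + RtoC (INR n) = (mu n + w2) / c2))%X).
  { intros n. unfold s1, s2, s3, s4, s5, s6, mu, mode, w1, w2, half_v, c2. rewrite RtoC_mul.
    repeat split; field; auto. }
  assert (Ndiv : forall z : Cplx, z <> 0%X -> (z / c2)%X <> 0%X).
  { intros z Hz E. apply Hz. transitivity (z / c2 * c2)%X; [field; exact Nc2|]. rewrite E. ring. }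
  assert (Nmul : forall z : Cplx, (z / c2)%X <> 0%X -> z <> 0%X).
  { intros z Hz E. apply Hz. rewrite E. field. exact Nc2. }
  set (D1 := fun n => ((mu n - w1) * (mu n + w1))%X).
  set (D2 := fun n => ((mu n - w2) * (mu n + w2))%X).
  assert (ND1 : forall n, D1 n <> 0%X) by (intros n; now apply Cmul_neq_0).
  assert (ND2 : forall n, D2 n <> 0%X) by (intros n; now apply Cmul_neq_0).
  assert (Ess : (s * s = w1 * w2)%X) by (rewrite hs; unfold w1, w2; ring).
  (* The normalisation at n = 0. It equals P / (v^2 c^2 - s^2), so the prefactor of the theorem
     times [K] is 2^v a. *)
  set (K := (D1 O * D2 O / ((mu O - s) * (mu O + s)))%X).
  assert (NK1 : (mu O - s)%X <> 0%X).
  { apply Nmul. destruct (Es O) as [<- _]. now apply not_in_Z0neg. }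
  assert (NK2 : (mu O + s)%X <> 0%X).
  { apply Nmul. destruct (Es O) as [_ [<- _]]. now apply not_in_Z0neg. }
  set (h := hyp_term [v; Cadd Cone s1; Cadd Cone s2; s3; s4; s5; s6]
    [s1; s2; Cadd Cone s3; Cadd Cone s4; Cadd Cone s5; Cadd Cone s6] Cone).
  (* Since s^2 = w1 w2, mu^2 - s^2 = D1 + w1 (w1 - w2). Dividing by D1 D2 leaves 1 / D2, of order
     n^(-2), times a bounded factor, which makes the convergence visible. *)
  assert (Eh : forall n, h n = (binom_coef v n
    * (K * (/ D2 n * (1 + w1 * (w1 - w2) * / D1 n))))%X).
  { intros n. unfold h. rewrite hyp_term_very_well_poised.
    2: intros k; now apply not_in_Z0neg.
    2: intros k; now apply not_in_Z0neg.
    2: intros k; destruct (Es k) as (_ & _ & -> & _); auto.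
    2: intros k; destruct (Es k) as (_ & _ & _ & -> & _); auto.
    2: intros k; destruct (Es k) as (_ & _ & _ & _ & -> & _); auto.
    2: intros k; destruct (Es k) as (_ & _ & _ & _ & _ & ->); auto.
    destruct (Es n) as (-> & -> & -> & -> & -> & ->).
    destruct (Es O) as (Z1 & Z2 & Z3 & Z4 & Z5 & Z6).
    assert (E0 : forall z : Cplx, (z + RtoC (INR 0))%X = z)
      by (intros z; simpl; change (RtoC 0) with Czero; ring).
    rewrite E0 in Z1, Z2, Z3, Z4, Z5, Z6. rewrite Z1, Z2, Z3, Z4, Z5, Z6.
    transitivity (binom_coef v n * K
      * ((mu n * mu n - s * s) / (D1 n * D2 n)))%X.
    - unfold K, D1, D2. field. repeat split; auto.
    - rewrite Ess. unfold D1, D2. field. repeat split; auto. }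
  destruct (mode_inv_bound v c w1 hc Q1 Q2) as (C1 & PC1 & B1).
  destruct (mode_inv_bound v c w2 hc Q3 Q4) as (C2 & PC2 & B2).
  assert (Sh : is_Cseries h (CSeries h)).
  { rewrite (CSeries_ext h _ Eh).
    eapply is_Cseries_ext; [intros n; symmetry; apply Eh|].
    apply is_Cseries_binom_coef
      with (C := Cnorm K * (C2 * (1 + Cnorm (w1 * (w1 - w2)) * C1))); [exact hv|].
    intros n. rewrite Cnorm_mul. unfold Rdiv. rewrite Rmult_assoc.
    apply Rmult_le_compat_l; [apply Cnorm_ge_0|]. rewrite Cnorm_mul.
    specialize (B1 n). specialize (B2 n). pose proof (pos_INR n) as Pn.
    fold mu in B1, B2. fold (D1 n) in B1. fold (D2 n) in B2.
    set (z := (w1 * (w1 - w2))%X). pose proof (Cnorm_ge_0 z) as Pz.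
    set (X := / ((INR n + 1) * (INR n + 2))).
    assert (PX : 0 < X) by (apply Rinv_0_lt_compat; nra).
    assert (X1 : X <= 1).
    { rewrite <- Rinv_1. apply Rinv_le_contravar; nra. }
    apply Rle_trans with (C2 * X * (1 + Cnorm z * C1)); [|lra].
    apply Rmult_le_compat; [apply Cnorm_ge_0|apply Cnorm_ge_0|exact B2|].
    eapply Rle_trans; [apply Cnorm_add|]. rewrite Cnorm_1, Cnorm_mul.
    apply Rplus_le_compat_l, Rmult_le_compat_l; [exact Pz|].
    apply Rle_trans with (C1 * X); [exact B1|]. rewrite <- (Rmult_1_r C1) at 2.
    now apply Rmult_le_compat_l. }
  assert (S1 := is_Cseries_binom_coef v (fun n => / D1 n)%X C1 hv B1).
  assert (S2 := is_Cseries_binom_coef v (fun n => / D2 n)%X C2 hv B2).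
  set (T := Cmul (Cdiv (Cmul (Cpow (RtoC 2) v)
    (Cadd (Csub (Cmul (Cmul (Cmul v v) a) (Cmul c c)) (Cmul (Cmul a a) a))
      (Cmul a (Cmul b b)))) P) (CSeries h)).
  exists T, (CSeries h). split; [|split; [now apply is_Cseries_Cseries_cv|reflexivity]].
  apply improper_integral_primitive; [|intros t Ht; now apply Ccontinuous_integrand].
  eapply has_improper_primitive_half_add;
    [apply (sinh_primitive v c w1); assumption|apply (sinh_primitive v c w2); assumption| |].
  - intros x. cbv beta. rewrite Csinh_mul_Ccosh.
    replace (w1 * RtoC x)%X with (a * RtoC x + b * RtoC x)%X by (unfold w1; ring).
    replace (w2 * RtoC x)%X with (a * RtoC x - b * RtoC x)%X by (unfold w2; ring).
    unfold Cdiv. ring.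
  - fold mu.
    (* The terms agree because w1 D2 + w2 D1 = (w1 + w2)(mu^2 - w1 w2) = 2 a (mu^2 - s^2). *)
    assert (A : is_Cseries (fun n => a * (v * c * (v * c) - s * s) / P * h n)%X
      (/ 2 * (w1 * CSeries (fun n => binom_coef v n * / D1 n)
        + w2 * CSeries (fun n => binom_coef v n * / D2 n)))%X).
    { eapply is_Cseries_ext; [|apply is_Cseries_scal, is_Cseries_add; apply is_Cseries_scal;
        [exact S1|exact S2]].
      intros n. cbv beta. rewrite Eh.
      assert (EP : (P = D1 O * D2 O)%X).
      { unfold P, D1, D2, mu, mode, w1, w2. simpl INR. rewrite Rmult_0_r.
        change (RtoC 0) with Czero. ring. }
      assert (EK : ((v * c * (v * c) - s * s) = (mu O - s) * (mu O + s))%X).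
      { unfold mu, mode. simpl INR. rewrite Rmult_0_r. change (RtoC 0) with Czero. ring. }
      rewrite EP, EK. unfold K.
      transitivity (binom_coef v n * (a * (/ D2 n * (1 + w1 * (w1 - w2) * / D1 n))))%X;
        [|field; auto 10].
      replace a with (/ 2 * (w1 + w2))%X by (unfold w1, w2; rewrite RtoC_2; field;
        intros X; apply (f_equal fst) in X; simpl in X; lra).
      transitivity (/ 2 * (binom_coef v n * ((w1 * D2 n + w2 * D1 n) / (D1 n * D2 n))))%X;
        [field; auto|].
      unfold D1, D2. field. auto 10. }
    (* The same series is evaluated twice, as the half-sum from the two integrals and as a multiple
       of the 7F6 series; uniqueness of the sum equates them. *)
    pose proof (is_Cseries_unique _ _ (is_Cseries_scal
      (a * (v * c * (v * c) - s * s) / P)%X _ _ Sh)) as B.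
    apply is_Cseries_unique in A. rewrite A in B.
    assert (E : forall w : Cplx, (forall n, (mu n - w)%X <> 0%X) -> (forall n, (mu n + w)%X <> 0%X) ->
      forall S, is_Cseries (fun n => binom_coef v n * / ((mu n - w) * (mu n + w)))%X S ->
      CSeries (fun n => binom_coef v n * (w / ((mu n - w) * (mu n + w))))%X = (w * S)%X).
    { intros w W1 W2 S HS. apply is_Cseries_unique.
      eapply is_Cseries_ext; [|exact (is_Cseries_scal w _ _ HS)].
      intros n. cbv beta. field. auto. }
    rewrite (E w1 NA1 NB1 _ S1), (E w2 NA2 NB2 _ S2).
    transitivity (Cpow 2 v * (a * (v * c * (v * c) - s * s) / P * CSeries h))%X.
    + unfold T. rewrite hs. unfold Cdiv. ring.
    + rewrite <- B. ring.
Qed.
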